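(* Let $\ell\ge 5$ be a prime and $\delta:=\frac{\ell^2-1}{24}$. Then: (i) $(M_e-M_o)(\ell n-\delta)\equiv 0\pmod{\ell}$ for all $n\in\mathbb{Z}$ if and only if $\ell=5$. (ii) Let $a\in\mathbb{Z}$ with $a\not\equiv-\delta\pmod{\ell}$. If $(M_e-M_o)(\ell n+a)\equiv 0\pmod{\ell}$ for all $n\in\mathbb{Z}$, then for every $b\in\mathbb{Z}$ satisfying $\left(\frac{a+\delta}{\ell}\right)=\left(\frac{b+\delta}{\ell}\right)$ one has $(M_e-M_o)(\ell n+b)\equiv 0\pmod{\ell}$ for all $n\in\mathbb{Z}$.
   Context: For a partition $\pi$ let $\pi_1$ be its largest part, $\mu(\pi)$ the number of ones in $\pi$, and $\nu(\pi)$ the number of parts of $\pi$ strictly larger than $\mu(\pi)$. The crank of $\pi$ is $\pi_1$ if $\mu(\pi)=0$ and $\nu(\pi)-\mu(\pi)$ if $\mu(\pi)>0$ (the empty partition has crank $0$). $M_e(n)$ and $M_o(n)$ denote the number of partitions of $n$ with even and odd crank respectively, with the usual crank convention at $n=1$, namely $M_e(1)=-1$, $M_o(1)=2$; and $(M_e-M_o)(n)=M_e(n)-M_o(n)$, which is $0$ for $n<0$. With this convention $$\sum_{n\ge 0}(M_e-M_o)(n)q^n=\prod_{n\ge1}\frac{(1-q^n)^3}{(1-q^{2n})^2}.$$ $\left(\frac{\cdot}{\ell}\right)$ is the Legendre symbol. *)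

(* Defs.v *)
From HB Require Import structures.
From mathcomp Require Import all_boot all_order all_algebra.

Set Implicit Arguments.
Unset Strict Implicit.
Unset Printing Implicit Defensive.

Import Order.TTheory GRing.Theory Num.Theory.

Definition is_partition (n : nat) (s : seq nat) : bool :=
  [&& sorted geq s, 0 \notin s & sumn s == n].

Definition largest_part (s : seq nat) : nat := \max_(k <- s) k.

Definition num_ones (s : seq nat) : nat := count_mem 1 s.

Definition num_above (s : seq nat) : nat := count (fun k => num_ones s < k) s.

Definition crank (s : seq nat) : int :=
  if num_ones s == 0 then Posz (largest_part s)
  else (Posz (num_above s) - Posz (num_ones s))%R.

Definition parts (n : nat) (t : n.-bseq 'I_n.+1) : seq nat :=
  [seq val i | i <- t].

Lemma parts_inj (n : nat) : injective (@parts n).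
Proof. by move=> t u /(inj_map val_inj) /val_inj. Qed.

(* A partition of n has at most n parts, all at most n, so the finite type
   n.-bseq 'I_n.+1 represents each partition of n (exactly once, by
   parts_inj). *)
Lemma partition_parts (n : nat) (s : seq nat) :
  is_partition n s -> exists t : n.-bseq 'I_n.+1, parts t = s.
Proof.
case/and3P=> _ s0 /eqP sn.
have sz : size s <= n.
  rewrite -sn; elim: s s0 {sn} => //= x s IH.
  rewrite inE negb_or => /andP[x0 /IH le_s].
  by rewrite -add1n leq_add // lt0n eq_sym.
have le_n x : x \in s -> x <= n.
  rewrite -sn; elim: s {s0 sn sz} => //= y s IH.
  rewrite inE => /orP[/eqP->|/IH le_x]; first exact: leq_addr.
  exact: leq_trans le_x (leq_addl _ _).
have szo : size [seq inord x : 'I_n.+1 | x <- s] <= n by rewrite size_map.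
exists (Bseq szo); rewrite /parts /= -map_comp -[RHS]map_id.
by apply/eq_in_map => x /le_n xn /=; rewrite inordK.
Qed.

Definition num_partitions (P : pred (seq nat)) (n : nat) : nat :=
  #|[set t : n.-bseq 'I_n.+1 | is_partition n (parts t) && P (parts t)]|.

Definition even_crank (s : seq nat) : bool := (2 %| crank s)%Z.

(* The values at n = 1 are the usual crank convention. They do not count the
   unique partition of 1, whose crank is -1. *)
Definition Me (n : nat) : int :=
  if n == 1 then (-1)%R else Posz (num_partitions even_crank n).

Definition Mo (n : nat) : int :=
  if n == 1 then 2%R else Posz (num_partitions (predC even_crank) n).

Definition MeMo (n : int) : int :=
  if n is Posz m then (Me m - Mo m)%R else 0%R.

Definition legendre (p : nat) (a : int) : int :=
  if (p %| a)%Z then 0%R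
  else if [exists x : 'I_p, (Posz x ^+ 2 == a %[mod p])%Z] then 1%R
  else (-1)%R.

(* The division is exact whenever l is coprime to 6, in particular for a
   prime l >= 5. *)
Definition delta (l : nat) : nat := (l ^ 2 - 1) %/ 24.

(* Main.v *)
(** Write D = q d/dq and work with power series over F_l, where the series of
    the (M_e - M_o)(n) is f = theta_4(q) / prod (1 + q^n).  With
    al = theta_3(q)^4, be = theta_4(q)^4 and x = be/al, all identities between
    theta constants that are needed come from the arithmetic-geometric mean
    relations for q -> q^2: both sides of each identity obey the same functional
    equation, and a comparison of orders of vanishing forces equality.  This
    yields D x = -x (1 - x) al, the hypergeometric equation of theta_3^2, and
    D log f.  Modulo l, theta_3^2 and the Hasse polynomial
    A(x) = sum_i C(m,i)^2 x^i, m = (l-1)/2, solve the same differential equation,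
    whence al^m A(x) is a constant.  So D is a derivation of F_l(x, al), and for
    T = D + delta the series T^j f is f al^j R_j(x) with R_j rational.

    As A has a simple root, 1, al, ..., al^(m-1) are independent over F_l(x).
    Congruence on the class of a means that the projector
    sum_j (a+delta)^(-j) T^j kills f; by independence only j and j + m can
    cancel, so T^(m+1) f = -((a+delta)/l) T f, a condition which only depends on
    the Legendre symbol.

    Congruence on the class of -delta means T^(l-1) f = f.  The order at A of
    T^j f can only jump for special j, and returning to f after l - 1 steps makes
    the jump at j = m + 1 so large that T^(m+1) f = f (t0 al + t1 be) with
    constants t0, t1.  The coefficients of q^0, ..., q^3 contradict this for
    l >= 7. *)

Require Import Defs.
From HB Require Import structures.
From mathcomp Require Import all_boot all_order all_algebra fingroup cyclic.
From mathcomp Require Import closed_field boolp ring zify.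

Set Implicit Arguments.
Unset Strict Implicit.
Unset Printing Implicit Defensive.

Import GRing.Theory.
Local Open Scope ring_scope.

(** * Formal power series *)

(** The shift by delta is D acting on q^(-1/24) f, because 24 delta = -1 modulo l; f^24 is q times a
    rational function of al and be.

    In characteristic l the kernel of D contains every series in q^l, so a differential equation
    alone never shows that a series is constant. Invariance under q -> q^2 closes this gap: a series
    with u(q^2) = u is constant.

    Denominators are removed by p = al / A(x), which is a constant times al^(m+1). Then D x = nu A p
    and D p = nu A' p^2 with nu = x^2 - x, so that T^j f = f p^j N_j(x) with polynomials N_j. The
    relation p^m A^(m+1) = const makes Frobenius explicit on p: p^l is a constant times p / A^(l+1).
    Comparing a linear relation among powers of p with its l-th power thus becomes a computation of
    multiplicities at a root of A.

    The index m + 1 comes from 1/2 = -m modulo l: the factor j + k + 1/2, which governs the order k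
    at A of N_j, vanishes exactly when j + k = m modulo l. *)

Record series (F : Type) := Series { scoef :> nat -> F }.

HB.instance Definition _ (F : Type) := gen_eqMixin (series F).
HB.instance Definition _ (F : Type) := gen_choiceMixin (series F).

Lemma seriesP (F : Type) (u v : series F) : u =1 v -> u = v.
Proof. by case: u v => [u] [v] /= /funext ->. Qed.

Section SeriesRing.
Variable F : fieldType.
Implicit Types u v w : series F.

Definition sadd u v := Series (fun n => u n + v n).
Definition sopp u := Series (fun n => - u n).
Definition szero := Series (fun _ => 0 : F).

Lemma saddA : associative sadd.
Proof. by move=> u v w; apply: seriesP => n /=; rewrite addrA. Qed.
Lemma saddC : commutative sadd.
Proof. by move=> u v; apply: seriesP => n /=; rewrite addrC. Qed.
Lemma sadd0 : left_id szero sadd.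
Proof. by move=> u; apply: seriesP => n /=; rewrite add0r. Qed.
Lemma saddN : left_inverse szero sopp sadd.
Proof. by move=> u; apply: seriesP => n /=; rewrite addNr. Qed.

HB.instance Definition _ :=
  GRing.isZmodule.Build (series F) saddA saddC sadd0 saddN.

Definition smul u v := Series (fun n => \sum_(i < n.+1) u i * v (n - i)%N).
Definition sconst (c : F) := Series (fun n => if n == 0%N then c else 0).
Definition trunc N u : {poly F} := \poly_(i < N) u i.

Lemma smul_trunc N u v n : (n < N)%N -> smul u v n = (trunc N u * trunc N v)`_n.
Proof.
move=> nN; rewrite coefM /=; apply: eq_bigr => i _.
by rewrite !coef_poly (leq_ltn_trans (leq_subr _ _)) // (leq_ltn_trans _ nN) // -ltnS.
Qed.

Lemma smulC : commutative smul.
Proof.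
by move=> u v; apply: seriesP => n; rewrite !(@smul_trunc n.+1) // mulrC.
Qed.
Lemma smulA : associative smul.
Proof.
move=> u v w; apply: seriesP => n.
have -> : smul u (smul v w) n = (trunc n.+1 u * (trunc n.+1 v * trunc n.+1 w))`_n.
  rewrite coefM /=; apply: eq_bigr => i _.
  rewrite coef_poly ltn_ord; congr (_ * _).
  by rewrite -(@smul_trunc n.+1) // ltnS leq_subr.
rewrite mulrA coefM /=; apply: eq_bigr => i _.
rewrite -(@smul_trunc n.+1) ?ltn_ord //; congr (_ * _).
by rewrite coef_poly ltnS leq_subr.
Qed.
Lemma smul1 : left_id (sconst 1) smul.
Proof.
move=> u; apply: seriesP => n /=; rewrite big_ord_recl /= mul1r subn0.
by rewrite big1 ?addr0 // => i _; rewrite mul0r.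
Qed.
Lemma smulDl : left_distributive smul sadd.
Proof.
move=> u v w; apply: seriesP => n /=; rewrite -big_split /=.
by apply: eq_bigr => i _; rewrite mulrDl.
Qed.
Lemma sone_neq0 : sconst 1 != 0.
Proof. by apply/eqP => /(congr1 (fun u => scoef u 0)) /= /eqP; rewrite oner_eq0. Qed.

HB.instance Definition _ :=
  GRing.Zmodule_isComNzRing.Build (series F) smulA smulC smul1 smulDl sone_neq0.

Lemma scoefD u v n : (u + v) n = u n + v n. Proof. by []. Qed.
Lemma scoefN u n : (- u) n = - u n. Proof. by []. Qed.
Lemma scoefB u v n : (u - v) n = u n - v n. Proof. by []. Qed.
Lemma scoef0 n : (0 : series F) n = 0. Proof. by []. Qed.
Lemma scoef1 n : (1 : series F) n = (n == 0%N)%:R.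
Proof. by rewrite /=; case: (n == 0%N). Qed.
Lemma scoefM u v n : (u * v) n = \sum_(i < n.+1) u i * v (n - i)%N.
Proof. by []. Qed.
Lemma scoefM0 u v : (u * v) 0%N = u 0%N * v 0%N.
Proof. by rewrite scoefM big_ord1. Qed.
Lemma scoef_sum I (r : seq I) (P : pred I) (G : I -> series F) n :
  (\sum_(i <- r | P i) G i) n = \sum_(i <- r | P i) G i n.
Proof. by elim/big_rec2: _ => // i x y _ <-. Qed.
Lemma scoefMn u k n : (u *+ k) n = u n *+ k.
Proof. by elim: k => //= k IH; rewrite !mulrS scoefD IH. Qed.
Lemma scoef_nat k n : (k%:R : series F) n = if n == 0%N then k%:R else 0.
Proof. by rewrite scoefMn scoef1; case: (n == 0%N); rewrite // mul0rn. Qed.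
Lemma scoefX0 u k : (u ^+ k) 0%N = u 0%N ^+ k.
Proof. by elim: k => [|k IH]; rewrite ?expr0 // !exprS scoefM0 IH. Qed.

Lemma scoef_natM k u n : (k%:R * u) n = k%:R * u n.
Proof. by rewrite mulr_natl scoefMn mulr_natl. Qed.

Lemma sconst_is_monoid_morphism : monoid_morphism sconst.
Proof.
split=> // c d; apply: seriesP => -[|n]; first by rewrite scoefM0.
rewrite scoefM big_ord_recl /= mulr0 big1 ?addr0 // => i _.
by rewrite mul0r.
Qed.
Lemma sconst_is_additive : zmod_morphism sconst.
Proof. by move=> c d; apply: seriesP => -[|n] //=; rewrite subr0. Qed.
HB.instance Definition _ := GRing.isZmodMorphism.Build F (series F) sconst sconst_is_additive.
HB.instance Definition _ := GRing.isMonoidMorphism.Build F (series F) sconst sconst_is_monoid_morphism.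

Lemma scoefZ c u n : (sconst c * u) n = c * u n.
Proof.
rewrite scoefM big_ord_recl /= subn0 big1 ?addr0 // => i _.
by rewrite mul0r.
Qed.

(** * Orders of vanishing, inverses, and absence of zero divisors *)

Definition ordge k u := forall i, (i < k)%N -> u i = 0.

Lemma ordge0 u : ordge 0 u. Proof. by []. Qed.
Lemma ordgeW j k u : (j <= k)%N -> ordge k u -> ordge j u.
Proof. by move=> jk uk i ij; apply: uk; apply: leq_trans ij jk. Qed.
Lemma ordgeD k u v : ordge k u -> ordge k v -> ordge k (u + v).
Proof. by move=> uk vk i ik; rewrite scoefD uk // vk // addr0. Qed.
Lemma ordgeN k u : ordge k u -> ordge k (- u).
Proof. by move=> uk i ik; rewrite scoefN uk // oppr0. Qed.
Lemma ordgeM j k u v : ordge j u -> ordge k v -> ordge (j + k) (u * v).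
Proof.
move=> uj vk n nlt; rewrite scoefM big1 // => i _.
have [ij|ji] := ltnP i j; first by rewrite uj // mul0r.
by rewrite vk ?mulr0 // ltn_subLR ?(leq_trans nlt) ?leq_add2r // -ltnS.
Qed.
Lemma ordgeMl k u v : ordge k u -> ordge k (u * v).
Proof. by move=> uk; rewrite -(addn0 k); apply: ordgeM. Qed.
Lemma ordge_lead j k u v : ordge j u -> ordge k v -> (u * v) (j + k)%N = u j * v k.
Proof.
move=> uj vk; rewrite scoefM.
have jlt : (j < (j + k).+1)%N by rewrite ltnS leq_addr.
rewrite (bigD1 (Ordinal jlt)) //= addKn big1 ?addr0 // => i /eqP/val_eqP /= ij.
have [lt_ij|ji] := ltnP i j; first by rewrite uj // mul0r.
have ltji : (j < i)%N by rewrite ltn_neqAle eq_sym ij.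
rewrite vk ?mulr0 // ltn_subLR ?ltn_add2r //.
by rewrite -ltnS.
Qed.
Lemma ordgeX k u n : ordge k u -> ordge (n * k) (u ^+ n).
Proof.
move=> uk; elim: n => [|n IH]; first by rewrite mul0n.
by rewrite exprS mulSn; apply: ordgeM.
Qed.

Lemma series_lead u : u != 0 -> exists2 k, ordge k u & u k != 0.
Proof.
move=> u0; have ex : exists n, u n != 0.
  apply: contrapT => H; case/eqP: u0; apply: seriesP => n.
  by apply/eqP; apply: contrapT => /negP un; apply: H; exists n.
case: (ex_minnP ex) => k uk kmin; exists k => // i ik.
by apply/eqP; apply: contraLR ik => /kmin; rewrite -leqNgt.
Qed.

(** A geometric series in w, which has order at least 1, so that powers up to n suffice for the
    coefficient of q^n. Non-units are fixed, as the convention for inverses in unit rings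
    demands. *)
Definition sinv u :=
  if u 0%N == 0 then u else
  let w := 1 - sconst (u 0%N)^-1 * u in
  Series (fun n => (sconst (u 0%N)^-1 * \sum_(k < n.+1) w ^+ k) n).

Lemma smulVr : {in [pred u | (scoef u 0%N) != 0], left_inverse 1 sinv *%R}.
Proof.
move=> u; rewrite inE => u0; rewrite /sinv (negPf u0).
set c := sconst _; set w := 1 - c * u; set g := Series _.
have w1 : ordge 1 w.
  by move=> [|//] _; rewrite scoefB scoefM0 /= mulVf // subrr.
apply: seriesP => n.
have -> : (g * u) n = (c * (\sum_(k < n.+1) w ^+ k) * u) n.
  rewrite !(scoefM _ u); apply: eq_bigr => i _; congr (_ * _).
  rewrite -[scoef g i]/((c * \sum_(k < i.+1) w ^+ k) i) !scoefZ; congr (_ * _).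
  rewrite !scoef_sum (big_ord_widen n.+1 (fun k => (w ^+ k) i)) ?ltn_ord //.
  rewrite big_mkcond /=; apply: eq_bigr => k _; case: ifP => // /negbT; rewrite -leqNgt => ik.
  by rewrite (ordgeX w1) // muln1.
have -> : c * (\sum_(k < n.+1) w ^+ k) * u = 1 - w ^+ n.+1.
  have -> : c * (\sum_(k < n.+1) w ^+ k) * u = (1 - w) * \sum_(k < n.+1) w ^+ k.
    by rewrite /w; ring.
  by rewrite -(opprB w 1) mulNr -subrX1 opprB.
by rewrite scoefB (ordgeX w1) ?muln1 // subr0.
Qed.

Lemma sunitPl u v : v * u = 1 -> (u 0%N) != 0.
Proof.
move/(congr1 (fun s => scoef s 0)); rewrite scoefM0 scoef1 /= => vu.
by apply/eqP => u0; move/eqP: vu; rewrite u0 mulr0 eq_sym oner_eq0.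
Qed.

Lemma sinv_out : {in [predC [pred u | (scoef u 0%N) != 0]], sinv =1 id}.
Proof. by move=> u; rewrite !inE negbK /sinv => ->. Qed.

HB.instance Definition _ := GRing.ComNzRing_hasMulInverse.Build (series F)
  smulVr sunitPl sinv_out.

Lemma sunitE u : (u \is a GRing.unit) = (u 0%N != 0).
Proof. by []. Qed.

Lemma series_idomain : GRing.integral_domain_axiom (series F).
Proof.
move=> u v uv; apply/norP => -[/series_lead[j uj u0] /series_lead[k vk v0]].
have := ordge_lead uj vk; rewrite uv scoef0 => /esym/eqP.
by rewrite mulf_eq0 (negPf u0) (negPf v0).
Qed.

HB.instance Definition _ :=
  GRing.ComUnitRing_isIntegral.Build (series F) series_idomain.

Definition qvar : series F := Series (fun n => (n == 1)%:R).

Lemma scoef_qX k n : (qvar ^+ k) n = (n == k)%:R.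
Proof.
elim: k n => [|k IH] n; first by rewrite expr0 scoef1.
rewrite exprS scoefM; case: n => [|n]; first by rewrite big_ord1 /= mul0r.
rewrite !big_ord_recl /= mul0r add0r mul1r subn1 IH big1 ?addr0 //.
by move=> i _; rewrite /bump /= mul0r.
Qed.

Lemma scoef_qXM k u n : (qvar ^+ k * u) n = if (k <= n)%N then u (n - k)%N else 0.
Proof.
rewrite scoefM; case: leqP => kn.
  have kn' : (k < n.+1)%N by [].
  rewrite (bigD1 (Ordinal kn')) //= scoef_qX eqxx mul1r big1 ?addr0 //.
  by move=> i /eqP/val_eqP /= ik; rewrite scoef_qX (negPf ik) mul0r.
rewrite big1 // => i _; rewrite scoef_qX; case: eqP => [ik|]; last by rewrite mul0r.
by have := ltn_ord i; rewrite ik ltnS leqNgt kn.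
Qed.

Lemma ordge_qX k : ordge k (qvar ^+ k).
Proof. by move=> i ik; rewrite scoef_qX ltn_eqF. Qed.

Lemma qvar_neq0 : qvar != 0.
Proof. by apply/eqP => /(congr1 (fun s => scoef s 1%N))/eqP; rewrite /= oner_eq0. Qed.

Definition qder u : series F := Series (fun n => n%:R * u n).

Lemma qderD u v : qder (u + v) = qder u + qder v.
Proof. by apply: seriesP => n; rewrite /= mulrDr. Qed.
Lemma qderN u : qder (- u) = - qder u.
Proof. by apply: seriesP => n; rewrite /= mulrN. Qed.
Lemma qderB u v : qder (u - v) = qder u - qder v.
Proof. by rewrite qderD qderN. Qed.
Lemma qderM u v : qder (u * v) = qder u * v + u * qder v.
Proof.
apply: seriesP => n; rewrite scoefD !scoefM [LHS]mulr_sumr -big_split /=.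
apply: eq_bigr => i _; rewrite -{1}(@subnKC i n) -1?ltnS // natrD mulrDl mulrA.
by congr (_ + _); rewrite mulrCA.
Qed.
Lemma qder_const c : qder (sconst c) = 0.
Proof. by apply: seriesP => -[|n] /=; rewrite ?mul0r ?mulr0. Qed.
Lemma qder0 : qder 0 = 0.
Proof. by apply: seriesP => n /=; rewrite mulr0. Qed.
Lemma qder1 : qder 1 = 0.
Proof. exact: qder_const. Qed.
Lemma qderMn u k : qder (u *+ k) = qder u *+ k.
Proof. by elim: k => [|k IH]; rewrite ?qder0 // !mulrS qderD IH. Qed.
Lemma qder_nat k : qder k%:R = 0.
Proof. by rewrite qderMn qder1 mul0rn. Qed.
Lemma qderX u n : qder (u ^+ n) = n%:R * u ^+ n.-1 * qder u.
Proof.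
elim: n => [|n IH]; first by rewrite qder1 !mul0r.
rewrite exprS qderM IH; case: n {IH} => [|n] /=; first by rewrite expr0; ring.
by rewrite !exprS -[in RHS]natr1; ring.
Qed.
Lemma qder_qvar : qder qvar = qvar.
Proof. by apply: seriesP => -[|[|n]] /=; rewrite ?mul0r ?mul1r ?mulr0. Qed.

(** * The substitutions q -> q^2 and q -> -q *)

Definition sq u : series F := Series (fun n => if odd n then 0 else u n./2).
Definition sneg u : series F := Series (fun n => (-1) ^+ n * u n).

Lemma sneg_coef u n : sneg u n = (-1) ^+ n * u n. Proof. by []. Qed.
Lemma sq_even u n : sq u n.*2 = u n.
Proof. by rewrite /= odd_double doubleK. Qed.
Lemma sq_odd u n : sq u n.*2.+1 = 0.
Proof. by rewrite /= odd_double. Qed.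

Lemma sq_is_additive : zmod_morphism sq.
Proof. by move=> u v; apply: seriesP => n /=; case: ifP; rewrite ?subr0. Qed.

Lemma sum_even (G : nat -> F) n :
  (forall k, odd k -> G k = 0) ->
  \sum_(i < n.*2.+1) G i = \sum_(i < n.+1) G i.*2.
Proof.
move=> Godd; elim: n => [|n IH]; first by rewrite !big_ord1.
rewrite doubleS 2!big_ord_recr /= IH [RHS]big_ord_recr /=.
by rewrite (Godd n.*2.+1) /= ?odd_double // addr0.
Qed.

Lemma sq_is_monoid_morphism : monoid_morphism sq.
Proof.
split; first by apply: seriesP => -[|[|n]] //=; case: ifP.
move=> u v; apply: seriesP => n; rewrite -(odd_double_half n).
case: (odd n); rewrite ?add0n ?add1n; last first.
  rewrite sq_even !scoefM (@sum_even (fun i => sq u i * sq v (n./2.*2 - i)%N)); last first.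
    by move=> k /= ->; rewrite mul0r.
  apply: eq_bigr => i _; rewrite -doubleB !sq_even //.
rewrite sq_odd scoefM big1 // => i _ /=.
case: ifP => oi; first by rewrite mul0r.
by rewrite oddB ?oi /= ?odd_double ?mulr0 // -ltnS.
Qed.
HB.instance Definition _ := GRing.isZmodMorphism.Build (series F) (series F) sq sq_is_additive.
HB.instance Definition _ := GRing.isMonoidMorphism.Build (series F) (series F) sq sq_is_monoid_morphism.

Lemma sneg_is_additive : zmod_morphism sneg.
Proof. by move=> u v; apply: seriesP => n /=; rewrite mulrBr. Qed.
Lemma sneg_is_monoid_morphism : monoid_morphism sneg.
Proof.
split; first by apply: seriesP => -[|n] /=; rewrite ?mulr0 ?expr0 ?mul1r.
move=> u v; apply: seriesP => n; rewrite /= mulr_sumr; apply: eq_bigr => i _.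
rewrite -{1}(@subnKC i n) -1?ltnS // exprD; ring.
Qed.
HB.instance Definition _ := GRing.isZmodMorphism.Build (series F) (series F) sneg sneg_is_additive.
HB.instance Definition _ := GRing.isMonoidMorphism.Build (series F) (series F) sneg sneg_is_monoid_morphism.

Lemma sneg_sq u : sneg (sq u) = sq u.
Proof.
apply: seriesP => n /=; case: ifP => on; first by rewrite mulr0.
by rewrite -signr_odd on mul1r.
Qed.
Lemma sq_coef0 u : sq u 0%N = u 0%N. Proof. by []. Qed.
Lemma qder_sq u : qder (sq u) = (sq (qder u)) *+ 2.
Proof.
apply: seriesP => n; rewrite scoefMn /=; case: ifP => on; first by rewrite mulr0 mul0rn.
by rewrite -{1}(odd_double_half n) on add0n -mul2n natrM -mulrA mulr_natl.
Qed.
Lemma sq_qvar : sq qvar = qvar ^+ 2.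
Proof. by apply: seriesP => n; rewrite scoef_qX /=; case: n => [|[|[|[|n]]]] //=; case: ifP. Qed.
Lemma sneg_qvar : sneg qvar = - qvar.
Proof. by apply: seriesP => -[|[|n]] //=; rewrite ?mulr0 ?oppr0 // mulr1. Qed.
Lemma sq_ordge k u : ordge k u -> ordge k.*2 (sq u).
Proof.
move=> uk i ik /=; case: ifP => // oi; apply: uk; lia.
Qed.
Lemma sq_inj u : sq u = 0 -> u = 0.
Proof.
by move=> H; apply: seriesP => n; rewrite -[LHS]sq_even H.
Qed.

Lemma sq_const c : sq (sconst c) = sconst c.
Proof. by apply: seriesP => -[|[|n]] //=; case: ifP. Qed.

Lemma sq_fixed u : sq u = u -> u = sconst (u 0%N).
Proof.
move=> H; apply: seriesP => n; rewrite /=; elim/ltn_ind: n => -[|n] // IH.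
rewrite -H /=; case: ifP => // on; have := IH n.+1./2.
move=> ->; last by lia.
by case: eqP => //; lia.
Qed.

(** * Coefficientwise limits *)

Definition qlim (x : nat -> series F) u :=
  forall n, exists N, forall M, (N <= M)%N -> forall i, (i <= n)%N -> x M i = u i.

Lemma qlim_cst u : qlim (fun _ => u) u.
Proof. by move=> n; exists 0%N. Qed.
Lemma qlim_unique x u v : qlim x u -> qlim x v -> u = v.
Proof.
move=> xu xv; apply: seriesP => n; have [N HN] := xu n; have [M HM] := xv n.
by rewrite -(HN (maxn N M)) ?leq_maxl // (HM (maxn N M)) ?leq_maxr.
Qed.
Lemma qlimD x y u v : qlim x u -> qlim y v -> qlim (fun n => x n + y n) (u + v).
Proof.
move=> xu yv n; have [N HN] := xu n; have [M HM] := yv n.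
exists (maxn N M) => K; rewrite geq_max => /andP[NK MK] i ni.
by rewrite !scoefD HN // HM.
Qed.
Lemma qlimM x y u v : qlim x u -> qlim y v -> qlim (fun n => x n * y n) (u * v).
Proof.
move=> xu yv n; have [N HN] := xu n; have [M HM] := yv n.
exists (maxn N M) => K; rewrite geq_max => /andP[NK MK] i ni.
rewrite !scoefM; apply: eq_bigr => j _; rewrite HN ?HM //.
  exact: leq_trans (leq_subr _ _) ni.
by apply: leq_trans ni; rewrite -ltnS.
Qed.
Lemma qlim_eq x y u : (forall n, x n = y n) -> qlim x u -> qlim y u.
Proof. by move=> xy xu n; have [N HN] := xu n; exists N => M /HN; rewrite xy. Qed.
Lemma qlim_shift k x u : qlim x u -> qlim (fun n => x (n + k)%N) u.
Proof. by move=> xu n; have [N HN] := xu n; exists N => M NM; apply/HN/(leq_trans NM)/leq_addr. Qed.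
Lemma qlim_double x u : qlim x u -> qlim (fun n => x n.*2) u.
Proof.
move=> xu n; have [N HN] := xu n; exists N => M NM; apply: HN.
by rewrite -addnn (leq_trans NM) ?leq_addr.
Qed.
Lemma qlim_sq x u : qlim x u -> qlim (fun n => sq (x n)) (sq u).
Proof.
move=> xu n; have [N HN] := xu n; exists N => M NM i ni /=.
by case: ifP => // _; apply: HN => //; lia.
Qed.
Lemma qlim_neg x u : qlim x u -> qlim (fun n => sneg (x n)) (sneg u).
Proof.
by move=> xu n; have [N HN] := xu n; exists N => M NM i ni /=; rewrite HN.
Qed.
Lemma qlim_near (x : nat -> series F) u : (forall n, ordge n (x n - u)) -> qlim x u.
Proof.
move=> H n; exists n.+1 => M nM i ni; apply/eqP; rewrite -subr_eq0 -scoefB.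
by apply/eqP; apply: H; apply: leq_ltn_trans nM.
Qed.

Lemma qlim_cauchy (x : nat -> series F) :
  (forall n, ordge n (x n.+1 - x n)) -> qlim x (Series (fun n => x n.+1 n)).
Proof.
move=> H; have step i M : (i < M)%N -> x M i = x i.+1 i.
  elim: M => // M IH; rewrite ltnS leq_eqVlt => /orP[/eqP->//|iM].
  by rewrite -IH //; apply/eqP; rewrite -subr_eq0 -scoefB H.
by move=> n; exists n.+1 => M nM i ni; apply: step; apply: leq_trans nM.
Qed.

End SeriesRing.

Arguments qvar {F}.

(** * Infinite products and Gauss' identity *)

Section Products.
Variable F : fieldType.
Local Notation S := (series F).
Local Notation q := (@qvar F).
Implicit Types u v w : S.

Definition iprod (c : nat -> S) : S :=
  Series (fun n => (\prod_(i < n.+1) (1 + c i)) n).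
Definition isum (c : nat -> S) : S :=
  Series (fun n => (\sum_(i < n.+1) c i) n).

Lemma qlim_prod (c : nat -> S) : (forall i, ordge i (c i)) ->
  qlim (fun N => \prod_(i < N) (1 + c i)) (iprod c).
Proof.
move=> Hc; apply: qlim_cauchy => n; rewrite big_ord_recr /= mulrDr mulr1 addrAC subrr add0r.
by rewrite -(add0n n); apply: ordgeM.
Qed.

Lemma qlim_sum (c : nat -> S) : (forall i, ordge i (c i)) ->
  qlim (fun N => \sum_(i < N) c i) (isum c).
Proof.
by move=> Hc; apply: qlim_cauchy => n; rewrite big_ord_recr /= addrAC subrr add0r.
Qed.

Definition epart N : S := \prod_(i < N) (1 + - q ^+ i.+1).
Definition vpart N : S := \prod_(i < N) (1 + q ^+ i.+1).
Definition eser : S := iprod (fun i => - q ^+ i.+1).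
Definition vser : S := iprod (fun i => q ^+ i.+1).

Lemma qlim_e : qlim epart eser.
Proof. by apply: qlim_prod => i; apply/ordgeN/(ordgeW (leqnSn i))/ordge_qX. Qed.
Lemma qlim_v : qlim vpart vser.
Proof. by apply: qlim_prod => i; apply/(ordgeW (leqnSn i))/ordge_qX. Qed.

Lemma epartS N : epart N.+1 = epart N * (1 - q ^+ N.+1).
Proof. by rewrite /epart big_ord_recr. Qed.
Lemma vpartS N : vpart N.+1 = vpart N * (1 + q ^+ N.+1).
Proof. by rewrite /vpart big_ord_recr. Qed.

Lemma epart0E N : epart N 0%N = 1.
Proof.
elim: N => [|N IH]; first by rewrite /epart big_ord0.
by rewrite epartS scoefM0 IH mul1r scoefB scoef_qX subr0.
Qed.
Lemma vpart0E N : vpart N 0%N = 1.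
Proof.
elim: N => [|N IH]; first by rewrite /vpart big_ord0.
by rewrite vpartS scoefM0 IH mul1r scoefD scoef_qX addr0.
Qed.
Lemma e0E : eser 0%N = 1.
Proof. by have [N /(_ N (leqnn N) 0%N (leqnn _)) <-] := qlim_e 0; rewrite epart0E. Qed.
Lemma v0E : vser 0%N = 1.
Proof. by have [N /(_ N (leqnn N) 0%N (leqnn _)) <-] := qlim_v 0; rewrite vpart0E. Qed.

Lemma eser_neq0 : eser != 0.
Proof. by apply/eqP => H; have := e0E; rewrite H scoef0 => /esym/eqP; rewrite oner_eq0. Qed.
Lemma vser_neq0 : vser != 0.
Proof. by apply/eqP => H; have := v0E; rewrite H scoef0 => /esym/eqP; rewrite oner_eq0. Qed.

Lemma sq_neq0 u : u != 0 -> sq u != 0.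
Proof. by apply: contra_neq => /sq_inj. Qed.

Lemma e_mul_v : eser * vser = sq eser.
Proof.
have H1 := qlimM qlim_e qlim_v; have H2 := qlim_sq qlim_e.
apply: (qlim_unique H1); apply: qlim_eq H2 => N.
elim: N => [|N IH]; first by rewrite /epart /vpart !big_ord0 rmorph1 mulr1.
rewrite epartS vpartS rmorphM /= IH rmorphB rmorph1 rmorphXn /= sq_qvar -exprM.
by rewrite mulnC exprM; ring.
Qed.

(** The product (1 + q^n)(1 + (-q)^n) is (1 + q^n)^2 for even n and 1 - q^(2n) for odd n. The odd
    factors up to 2N multiply to [sq (epart N.*2)] divided by [sq (sq (epart N))]; the denominator
    is moved to the left. *)
Lemma v_mul_neg_part N :
  vpart N.*2 * sneg (vpart N.*2) * sq (sq (epart N)) =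
  sq (vpart N) * sq (vpart N) * sq (epart N.*2).
Proof.
elim: N => [|N IH]; first by rewrite /epart /vpart !big_ord0 !rmorph1 !mulr1.
rewrite doubleS !epartS !vpartS !rmorphM !(rmorphB, rmorphD) !rmorph1 !rmorphXn /= in IH *.
rewrite sneg_qvar !sq_qvar rmorphXn /= sq_qvar.
have e1 : q ^+ N.*2 = (q ^+ N) ^+ 2 by rewrite -muln2 exprM.
have e2 : (- q) ^+ N.*2 = (q ^+ N) ^+ 2 by rewrite -mul2n exprM sqrrN -exprM mulnC exprM.
have e3 : (q ^+ 2) ^+ N = (q ^+ N) ^+ 2 by rewrite -!exprM mulnC.
have e4 : (q ^+ 2) ^+ N.*2 = (q ^+ N) ^+ 4 by rewrite -muln2 exprM e3 -exprM.
have e5 : (q ^+ 2 ^+ 2) ^+ N = (q ^+ N) ^+ 4 by rewrite -!exprM; congr (_ ^+ _); lia.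
rewrite !(exprS _ N.*2.+1) !(exprS _ N.*2) !(exprS _ N) e1 e2 e3 e4 e5.
move: IH; set A := vpart _; set A' := sneg A; set B := sq (sq _); set C := sq (vpart _).
set E := sq (epart _); set n := q ^+ N => IH.
transitivity ((A * A' * B) * ((1 + q * n ^+ 2) * (1 - q * n ^+ 2) * (1 + q ^+ 2 * n ^+ 2) ^+ 2 * (1 - q ^+ 4 * n ^+ 4))); first by rewrite /n; ring.
by rewrite IH; ring.
Qed.

Lemma v_mul_neg : vser * sneg vser = sq vser.
Proof.
have H1 := qlimM (qlimM (qlim_double qlim_v) (qlim_neg (qlim_double qlim_v))) (qlim_sq (qlim_sq qlim_e)).
have H2 := qlimM (qlimM (qlim_sq qlim_v) (qlim_sq qlim_v)) (qlim_sq (qlim_double qlim_e)).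
have H3 := qlim_unique (qlim_eq v_mul_neg_part H1) H2.
rewrite -{1}e_mul_v rmorphM /= in H3.
apply: (mulIf (sq_neq0 vser_neq0)); apply: (mulfI (sq_neq0 eser_neq0)).
transitivity (vser * sneg vser * (sq eser * sq vser)); first by ring.
by rewrite H3; ring.
Qed.

Definition issq n := [exists k : 'I_n.+1, (k * k == n)%N].
(** This is theta_4, the sum of (-1)^k q^(k^2) over all integers k: a square n = k^2 has the parity
    of k. *)
Definition tser : S :=
  Series (fun n => if n == 0%N then 1 else if issq n then (-1) ^+ n *+ 2 else 0).

Lemma issqP n : reflect (exists k, n = k * k)%N (issq n).
Proof.
apply: (iffP existsP) => [[k /eqP <-]|[k ->]]; first by exists k.
by exists (inord k) => /=; rewrite inordK //; nia.
Qed.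

Lemma sq_sum i n : (i <= n)%N ->
  \sum_(k < n) (i == k.+1 * k.+1)%N%:R * (-1) ^+ k.+1 =
  if (i != 0)%N && issq i then (-1) ^+ i else 0 :> F.
Proof.
move=> i_n; case: (posnP i) => [->|i0] /=.
  by rewrite big1 // => k _; rewrite mul0r.
rewrite -?lt0n ?(gtn_eqF i0) /=.
case: issqP => [[k ik]|H].
  have k0 : (0 < k)%N by nia.
  have kn : (k.-1 < n)%N by nia.
  rewrite ik (bigD1 (Ordinal kn)) //= prednK // eqxx mul1r.
  rewrite big1 ?addr0 => [|j]; first by rewrite -[RHS]signr_odd oddM andbb signr_odd.
  move=> /eqP/val_eqP /= jk.
  case: eqP => [H|]; last by rewrite mul0r.
  by case/eqP: jk; nia.
rewrite big1 // => k _; case: eqP => [ik|]; last by rewrite mul0r.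
by case: H; exists k.+1.
Qed.

Definition tpart n : S := 1 + (\sum_(k < n) (-1) ^+ k.+1 * q ^+ (k.+1 * k.+1)) *+ 2.

Lemma sign_coef k u n : ((-1) ^+ k * u) n = (-1) ^+ k * u n.
Proof. by rewrite -signr_odd -[in RHS]signr_odd; case: (odd k); rewrite ?mulN1r ?mul1r. Qed.

Lemma tpart_coef n i : (i <= n)%N -> tpart n i = tser i.
Proof.
move=> i_n; rewrite /tpart scoefD scoefMn scoef_sum scoef1.
rewrite (eq_bigr (fun k : 'I_n => (i == k.+1 * k.+1)%N%:R * (-1) ^+ k.+1)); last first.
  by move=> k _; rewrite sign_coef scoef_qX mulrC.
rewrite sq_sum //=; case: eqP => [->|_] /=; first by rewrite mul0rn addr0.
rewrite add0r; by case: ifP => // _; rewrite mul0rn.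
Qed.

Lemma qlim_t : qlim tpart tser.
Proof. by move=> n; exists n => M nM i i_n; rewrite tpart_coef // (leq_trans i_n). Qed.

(** The odd squares cancel, and the even squares 4 k^2 give theta_3(q^4); theta_3 is [sneg tser]. *)
Lemma t_add_neg : tser + sneg tser = sq (sq (sneg tser)) *+ 2.
Proof.
apply: seriesP => n; rewrite scoefD scoefMn.
have [-> /=|n0] := posnP n; first by rewrite mul1r.
rewrite /= -(odd_double_half n) in n0 *; case: (odd n) n0; rewrite ?add1n ?add0n => n0.
  rewrite /= odd_double /= mul0rn.
  case: issqP => _; last by rewrite mulr0 addr0.
  by rewrite -signr_odd /= odd_double /=; ring.
rewrite odd_double doubleK double_eq0.
have -> : (n./2 == 0)%N = false by lia.
have -> : (-1) ^+ n./2.*2 = 1 :> F by rewrite -signr_odd odd_double.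
case: (boolP (odd n./2)) => o2.
  rewrite mul0rn; case: issqP => [[k Hk]|_]; last by rewrite mulr0 addr0.
  exfalso; have : odd k = false by have := congr1 odd Hk; rewrite odd_double oddM andbb.
  move=> ok; move: Hk; rewrite -(odd_double_half k) ok add0n; lia.
set m := n./2 in o2 *; have Em : m = (m./2).*2 by rewrite -{1}(odd_double_half m) (negPf o2).
have -> : (m./2 == 0)%N = false by lia.
have -> : issq m.*2 = issq m./2.
  apply/issqP/issqP => -[k Hk].
    have ok : odd k = false by have := congr1 odd Hk; rewrite odd_double oddM andbb.
    by exists k./2; move: Hk; rewrite -{1 2}(odd_double_half k) ok add0n; lia.
  by exists k.*2; lia.
case: ifP => _; last by rewrite !mulr0 addr0 mul0rn.
by rewrite mul1r mulrnAr -expr2 sqrr_sign; ring.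
Qed.

(** * Gauss' identity and the arithmetic-geometric mean relations *)

Section Gauss.
Hypothesis two_neq0 : 2%:R != 0 :> F.
Local Notation P n := (epart n / vpart n).

Lemma epart_unit n : epart n \is a GRing.unit.
Proof. by rewrite sunitE epart0E oner_eq0. Qed.
Lemma vpart_unit n : vpart n \is a GRing.unit.
Proof. by rewrite sunitE vpart0E oner_eq0. Qed.
Lemma oneDqX_unit n : 1 + q ^+ n \is a GRing.unit.
Proof.
rewrite sunitE scoefD scoef1 scoef_qX; case: n => [|n] //=.
by rewrite addr0 oner_eq0.
Qed.

(* Gauss' identity by telescoping: the sum over s <= n of these terms is the
   n-th partial theta series, and the terms with s > 0 vanish modulo q^(n+1). *)
Definition uterm n s : S :=
  (-1) ^+ s * q ^+ (s * n.+1) * (P n * (P s)^-1) * (2 * (1 + q ^+ s)^-1).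

Lemma ratioS n : P n.+1 * (1 + q ^+ n.+1) = P n * (1 - q ^+ n.+1).
Proof.
have vu := vpart_unit n; have ou := oneDqX_unit n.+1.
rewrite epartS vpartS invrM //; have w := mulVr ou; set W := _^-1 in w *.
transitivity (W * (1 + q ^+ n.+1) * (epart n / vpart n * (1 - q ^+ n.+1))); first by ring.
by rewrite w mul1r.
Qed.

Lemma ratioV_S s : (P s.+1)^-1 * (1 - q ^+ s.+1) = (P s)^-1 * (1 + q ^+ s.+1).
Proof.
have Pu n : P n \is a GRing.unit by rewrite unitrM unitrV vpart_unit epart_unit.
apply: (mulrI (Pu s)); apply: (mulrI (Pu s.+1)).
transitivity ((P s.+1 * (P s.+1)^-1) * (P s * (1 - q ^+ s.+1))); first by ring.
rewrite -ratioS mulrV // mul1r.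
transitivity ((P s * (P s)^-1) * (P s.+1 * (1 + q ^+ s.+1))); last by ring.
by rewrite mulrV // mul1r.
Qed.

(** The algebra of [uterm_step] with the inverses as variables: p, p1 are P n, P n.+1; r, r1 are the
    inverses of P s, P s.+1; x = q^(s+1), y = q^(n+1), z = q^((s+1)(n+1)), w is the inverse of 1 +
    x, and e = (-1)^s. *)
Lemma telescope_step (R : comNzRingType) (p p1 r r1 w x y z e : R) :
  p1 * (1 + y) = p * (1 - y) -> r1 * (1 - x) = r * (1 + x) -> w * (1 + x) = 1 ->
  (1 + y) * (-1 * e * (z * x) * (p1 * r1) * (2 * w) - -1 * e * z * (p * r1) * (2 * w)) =
  e * 2 * p * (r * z + r1 * (z * y)).
Proof.
move=> py rx wx.
transitivity (- e * z * r1 * 2 * w * (x * (p1 * (1 + y)) - (1 + y) * p)); first by ring.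
rewrite py.
transitivity (e * z * 2 * p * w * (r1 * (1 - x) + r1 * y * (1 + x))); first by ring.
rewrite rx.
transitivity (e * z * 2 * p * (w * (1 + x)) * (r + r1 * y)); first by ring.
by rewrite wx; ring.
Qed.

(** On the right, consecutive values of q^((s+1)(n+1)) / P s are added with alternating sign, so
    that the sum over s telescopes. *)
Lemma uterm_step n s :
  (1 + q ^+ n.+1) * (uterm n.+1 s.+1 - uterm n s.+1) =
  (-1) ^+ s * 2 * P n * ((P s)^-1 * q ^+ (s.+1 * n.+1) +
                         (P s.+1)^-1 * q ^+ (s.+2 * n.+1)).
Proof.
rewrite /uterm (_ : (s.+1 * n.+2 = s.+1 * n.+1 + s.+1)%N); last by lia.
rewrite (_ : (s.+2 * n.+1 = s.+1 * n.+1 + n.+1)%N); last by lia.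
rewrite !exprD (exprS (-1)).
exact: telescope_step (ratioS n) (ratioV_S s) (mulVr (oneDqX_unit s.+1)).
Qed.

Lemma ratio_unit n : P n \is a GRing.unit.
Proof. by rewrite unitrM unitrV vpart_unit epart_unit. Qed.

Lemma ratio0 : P 0 = 1.
Proof. by rewrite /epart /vpart !big_ord0 divr1. Qed.

Lemma uterm0 n : uterm n 0 = P n.
Proof.
have two_unit : (2 : S) \is a GRing.unit by rewrite sunitE scoef_nat.
by rewrite /uterm mul0n !expr0 ratio0 invr1 !mulr1 mul1r (_ : 1 + 1 = 2) // mulrV // mulr1.
Qed.

Lemma uterm_sum n : \sum_(s < n.+1) uterm n s = tpart n.
Proof.
elim: n => [|n IH].
  by rewrite big_ord1 uterm0 ratio0 /tpart big_ord0 mul0rn addr0.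
have tele m : (1 + q ^+ n.+1) * \sum_(s < m.+1) (uterm n.+1 s - uterm n s) =
    - (-1) ^+ m * 2 * P n * (P m)^-1 * q ^+ (m.+1 * n.+1).
  elim: m => [|m IHm].
    rewrite big_ord1 !uterm0 mul1n expr0 ratio0 invr1 mulr1.
    transitivity (P n.+1 * (1 + q ^+ n.+1) - (1 + q ^+ n.+1) * P n); first by ring.
    by rewrite ratioS; ring.
  rewrite big_ord_recr mulrDr IHm uterm_step (exprS (-1)).
  by move: (P n) (P m)^-1 (P m.+1)^-1 => p r r1; ring.
have {tele} := tele n; rewrite sumrB IH -[_ * 2 * P n * _]mulrA mulrV ?ratio_unit // mulr1.
move=> tele; rewrite big_ord_recr /= {2}/uterm mulrV ?ratio_unit // mulr1.
have ou := oneDqX_unit n.+1; apply: (mulrI ou).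
have -> : tpart n.+1 = tpart n + (-1) ^+ n.+1 * q ^+ (n.+1 * n.+1) *+ 2.
  by rewrite /tpart big_ord_recr /= mulrnDl addrA.
move/eqP: tele; rewrite mulrBr subr_eq => /eqP tele.
rewrite mulrDr tele (mulnS n.+1 n.+1) exprD; have w := mulVr ou; set W := _^-1 in w *.
set Y := q ^+ n.+1 in w *; rewrite (exprS (-1)); set e := (-1) ^+ n.
set Q := q ^+ _; set T := tpart n.
transitivity (- e * 2 * Q + (1 + Y) * T - e * Y * Q * 2 * (W * (1 + Y))); first by ring.
by rewrite w; ring.
Qed.

Lemma gauss_part n : ordge n (tpart n * vpart n - epart n).
Proof.
rewrite -uterm_sum big_ord_recl.
rewrite uterm0.
rewrite mulrDl divrK ?vpart_unit // addrAC subrr add0r mulr_suml.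
elim/big_rec: _ => [|i x _ Hx]; first by move=> k _; rewrite scoef0.
apply: ordgeD => //; set s := lift ord0 i.
have -> : uterm n s * vpart n = q ^+ (s * n.+1) *
    ((-1) ^+ s * (P n * (P s)^-1) * (2 * (1 + q ^+ s)^-1) * vpart n).
  by rewrite /uterm; ring.
have H : ordge n (q ^+ (s * n.+1) : S).
  by apply: ordgeW (@ordge_qX _ _); rewrite /= /bump; nia.
by apply: ordgeMl.
Qed.

Lemma gauss : tser * vser = eser.
Proof.
apply: (qlim_unique (qlimM qlim_t qlim_v)) => n.
have [N HN] := qlim_e n; exists (maxn N n.+1) => M; rewrite geq_max => /andP[NM nM] i i_n.
rewrite -(HN M) //; apply/eqP; rewrite -subr_eq0 -scoefB.
by apply/eqP; apply: gauss_part; apply: leq_ltn_trans nM.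
Qed.

(** After multiplication by v(q^2)^2, where v(q^2) = v(q) v(-q), Gauss' identity at q, -q and q^2
    turns both sides into e(q^2)^2. *)
Lemma t_mul_neg : tser * sneg tser = sq tser ^+ 2.
Proof.
have v0 := sq_neq0 vser_neq0; apply: (mulIf v0); apply: (mulIf v0).
have g1 := gauss; have g2 := congr1 (@sneg F) gauss; rewrite rmorphM /= in g2.
have g3 := congr1 (@sq F) gauss; rewrite rmorphM /= in g3.
have h1 := e_mul_v; have h2 := congr1 (@sneg F) e_mul_v; rewrite rmorphM /= sneg_sq in h2.
transitivity ((sq tser * sq vser) ^+ 2); last by ring.
rewrite g3; transitivity (sq eser * sq eser); last by ring.
rewrite -{1}h1 -h2 -g2 -g1 -v_mul_neg; ring.
Qed.

(* theta_3(q)^2 and theta_4(q)^2 *)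
Definition aser := sneg tser ^+ 2.
Definition bser := tser ^+ 2.

Lemma ab_sq : aser * bser = sq bser ^+ 2.
Proof. by rewrite /aser /bser -exprMn mulrC t_mul_neg rmorphXn. Qed.

(** Substituting q^2 doubles the order, so the order can only be 0; there the constant term is
    multiplied by c, which differs from 1. *)
Lemma sq_scale_eq0 (c : F) u : 1 - c != 0 -> u = sconst c * sq u -> u = 0.
Proof.
move=> c1 H; apply/eqP; apply: contraT => /series_lead[[|k] uk] /eqP []; last first.
  by rewrite H scoefZ (sq_ordge uk) ?mulr0 //; lia.
have := congr1 (fun s => scoef s 0) H; rewrite scoefZ sq_coef0 => /eqP.
rewrite -subr_eq0 -{1}[u 0%N]mul1r -mulrBl mulf_eq0 (negPf c1) => /eqP //.
Qed.

Hypothesis three_neq0 : 3%:R != 0 :> F.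

(** Squaring theta_3 + theta_4 = 2 theta_3(q^4) gives a + b = 4 a(q^4) - 2 b(q^2). Hence the
    difference G of the two sides satisfies G = -2 G(q^2), and 1 - (-2) = 3 is nonzero. *)
Lemma a_add_b : aser + bser = sq aser *+ 2.
Proof.
apply/eqP; rewrite -subr_eq0; apply/eqP; set G := _ - _.
apply: (@sq_scale_eq0 (- 2)); first by rewrite opprK -(natrD _ 1 2).
rewrite /G; have h1 := t_mul_neg; have h2 := t_add_neg.
have H : aser + bser + sq bser *+ 2 = sq (sq aser) *+ 4.
  transitivity ((tser + sneg tser) ^+ 2); last by rewrite h2 /aser !rmorphXn /=; ring.
  by rewrite [sq bser]rmorphXn -h1 /aser /bser; ring.
rewrite {1}(_ : aser + bser = sq (sq aser) *+ 4 - sq bser *+ 2); last by rewrite -H; ring.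
by rewrite rmorphN rmorph_nat !(rmorphB, rmorphD, rmorphMn) /=; ring.
Qed.

End Gauss.

End Products.

(** * Differential equations of the theta constants *)

Section Coefficients.
Variable F : fieldType.
Implicit Types u w : series F.

Lemma scoefM1 u w : (u * w) 1%N = u 0%N * w 1%N + u 1%N * w 0%N.
Proof. by rewrite scoefM !big_ord_recl big_ord0 /= addr0. Qed.
Lemma scoefM2 u w : (u * w) 2%N = u 0%N * w 2%N + u 1%N * w 1%N + u 2%N * w 0%N.
Proof. by rewrite scoefM !big_ord_recl big_ord0 /= addr0 !addrA. Qed.
Lemma scoefM3 u w : (u * w) 3%N =
  u 0%N * w 3%N + u 1%N * w 2%N + u 2%N * w 1%N + u 3%N * w 0%N.
Proof. by rewrite scoefM !big_ord_recl big_ord0 /= addr0 !addrA. Qed.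

Local Notation a := (@aser F).
Local Notation b := (@bser F).
Local Notation t := (@tser F).
Local Notation al := (a ^+ 2).
Local Notation be := (b ^+ 2).

Lemma t_coefs : [/\ t 0%N = 1, t 1%N = - 2, t 2%N = 0 & t 3%N = 0].
Proof.
split; rewrite //=.
- case: issqP => [_|[]]; last by exists 1%N.
  by rewrite expr1 mulNrn.
- by case: issqP => // -[[|[|k]] Hk]; exfalso; lia.
- by case: issqP => // -[[|[|k]] Hk]; exfalso; lia.
Qed.

Lemma b_coefs : [/\ b 0%N = 1, b 1%N = - 4, b 2%N = 4 & b 3%N = 0].
Proof.
have [t0 t1 t2 t3] := t_coefs; rewrite /bser expr2.
by split; rewrite ?scoefM0 ?scoefM1 ?scoefM2 ?scoefM3 t0 ?t1 ?t2 ?t3; ring.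
Qed.

Lemma a_negb : a = sneg b.
Proof. by rewrite /aser /bser rmorphXn. Qed.

Lemma a_coefs : [/\ a 0%N = 1, a 1%N = 4, a 2%N = 4 & a 3%N = 0].
Proof.
have [b0 b1 b2 b3] := b_coefs; rewrite a_negb.
by split; rewrite sneg_coef ?b0 ?b1 ?b2 ?b3; ring.
Qed.

Lemma al_coefs : [/\ al 0%N = 1, al 1%N = 8, al 2%N = 24 & al 3%N = 32].
Proof.
have [a0 a1 a2' a3] := a_coefs; rewrite expr2.
split.
- by rewrite scoefM0 a0; ring.
- by rewrite scoefM1 a0 a1; ring.
- by rewrite scoefM2 a0 a1 a2'; ring.
- by rewrite scoefM3 a0 a1 a2' a3; ring.
Qed.
Lemma be_coefs : [/\ be 0%N = 1, be 1%N = - 8, be 2%N = 24 & be 3%N = - 32].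
Proof.
have [a0 a1 a2' a3] := b_coefs; rewrite expr2.
split.
- by rewrite scoefM0 a0; ring.
- by rewrite scoefM1 a0 a1; ring.
- by rewrite scoefM2 a0 a1 a2'; ring.
- by rewrite scoefM3 a0 a1 a2' a3; ring.
Qed.

End Coefficients.

Section Differential.
Variable F : fieldType.
Hypothesis two_neq0 : 2%:R != 0 :> F.
Hypothesis three_neq0 : 3%:R != 0 :> F.
Local Notation S := (series F).
Local Notation q := (@qvar F).
Local Notation D := (@qder F).
Implicit Types u w : S.

(** * Derivatives of theta_3^2 and theta_4^2 from the relations for q -> q^2 *)

Section AGM.
Variables a b : S.
Hypothesis ab : a * b = sq b ^+ 2.
Hypothesis a2 : sq a *+ 2 = a + b.
Hypotheses (a0 : a 0%N = 1) (b0 : b 0%N = 1) (a1 : a 1%N = 4) (b1 : b 1%N = - 4).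

Lemma a_unit : a \is a GRing.unit.
Proof. by rewrite sunitE a0 oner_eq0. Qed.
Lemma b_unit : b \is a GRing.unit.
Proof. by rewrite sunitE b0 oner_eq0. Qed.

Lemma pow2_neq0 k : (2 ^ k)%:R != 0 :> F.
Proof. by rewrite natrX expf_neq0. Qed.

Lemma D_a2 : sq (D a) *+ 4 = D a + D b.
Proof. by rewrite -qderD -a2 qderMn qder_sq; ring. Qed.
Lemma DD_a2 : sq (D (D a)) *+ 8 = D (D a) + D (D b).
Proof. by rewrite -qderD -D_a2 qderMn qder_sq; ring. Qed.
Lemma D_b2 : sq b * sq (D b) *+ 4 = D a * b + a * D b.
Proof. by rewrite -qderM ab qderX qder_sq; ring. Qed.

(* The left-hand side Z satisfies 8 b(q^2) Z(q^2) = (a - b) Z, so that its order k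
   at 0, if finite, satisfies 2k = k + 1; and the coefficient of q vanishes. *)
Lemma qder_ratio : 2 * (a * D b - b * D a) + a * b * (a ^+ 2 - b ^+ 2) = 0.
Proof.
set Z := LHS.
have HZ : 8 * sq b * sq Z = (a - b) * Z.
  rewrite /Z !(rmorphB, rmorphD, rmorphM, rmorphXn, rmorph_nat) /=.
  transitivity (2 * (sq a *+ 2) * (sq b * sq (D b) *+ 4) - 4 * sq b ^+ 2 * (sq (D a) *+ 4)
    + (sq a *+ 2) * sq b ^+ 2 * ((sq a *+ 2) ^+ 2 - 4 * sq b ^+ 2)); first by ring.
  by rewrite a2 D_a2 D_b2 -ab; ring.
have abo : ordge 1 (a - b) by case=> // _; rewrite scoefB a0 b0 subrr.
have eight : (a - b) 1%N = (2 ^ 3)%:R by rewrite scoefB a1 b1; ring.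
apply/eqP; apply: contraT => /series_lead[k Zk] /eqP Z0; case: Z0.
have := congr1 (fun s => scoef s (1 + k)%N) HZ; rewrite (ordge_lead abo Zk) eight.
case: k Zk => [|[|k]] Zk.
- move=> _; have := congr1 (fun s => scoef s 0) HZ; rewrite !scoefM0 scoefB a0 b0 subrr mul0r.
  rewrite scoef_nat sq_coef0 b0 mulr1 /= => /eqP; rewrite mulf_eq0 (negPf (pow2_neq0 3)) => /eqP //.
- move=> _; rewrite /Z !expr2 !(scoefD, scoefN, scoefM1, scoefM0, scoef_nat) /=.
  by rewrite a0 a1 b0 b1; ring.
- have H : ordge k.+3.+1 (8 * sq b * sq Z).
    by rewrite mulrC; apply/ordgeMl/(ordgeW _ (sq_ordge Zk)); lia.
  by rewrite H // => /esym/eqP; rewrite mulf_eq0 (negPf (pow2_neq0 3)) => /eqP.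
Qed.

(** The second-order equation of theta_3^2, written in terms of D. Once D b and D (D b) are
    eliminated through [qder_ratio], the difference Z of the two sides satisfies 4 a^2 Z(q^2) =
    a(q^2)^2 Z. Comparing orders leaves only order 0, and there the constant terms would give 4 = 1,
    against 3 being nonzero. *)
Lemma qder2_a : 4 * (a * D (D a) - 2 * D a ^+ 2) = a ^+ 2 * b ^+ 2 * (a ^+ 2 - b ^+ 2).
Proof.
apply/eqP; rewrite -subr_eq0; apply/eqP; set Z := LHS.
have e1 : 2 * a * D b = 2 * b * D a - a * b * (a ^+ 2 - b ^+ 2).
  by apply/eqP; rewrite -subr_eq0 -[X in _ == X]qder_ratio; apply/eqP; ring.
have e2 : 4 * a ^+ 2 * D (D b) = 4 * a * b * D (D a)
    - ((a ^+ 2 - b ^+ 2) * (2 * a * b * D a + a * (2 * a * D b)) + 4 * a ^+ 3 * b * D a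
       - 2 * a * b ^+ 2 * (2 * a * D b)).
  have H := congr1 D e1; rewrite !(qderM, qderB, qderX, qder_nat) in H.
  apply/eqP; rewrite -subr_eq0; apply/eqP.
  move/eqP: H; rewrite -subr_eq0 => /eqP H; rewrite -[RHS](mulr0 (2 * a)) -H.
  by rewrite /=; ring.
have HZ : 32 * a ^+ 2 * sq Z = 8 * sq a ^+ 2 * Z.
  rewrite {1}/Z !(rmorphB, rmorphD, rmorphM, rmorphXn, rmorph_nat) /=.
  transitivity (2 * (2 * a ^+ 2 * ((sq a *+ 2) * (sq (D (D a)) *+ 8)) *+ 2
    - 8 * a ^+ 2 * (sq (D a) *+ 4) ^+ 2)
    - 2 * a ^+ 2 * (sq a *+ 2) ^+ 2 * sq b ^+ 2 * ((sq a *+ 2) ^+ 2 - 4 * sq b ^+ 2)); first by ring.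
  rewrite a2 D_a2 DD_a2 -ab.
  transitivity (8 * (a + b) * a ^+ 2 * D (D a) + 2 * (a + b) * (4 * a ^+ 2 * D (D b))
   - 4 * (2 * a * D a + 2 * a * D b) ^+ 2
   - 2 * a ^+ 2 * (a + b) ^+ 2 * (a * b) * (a - b) ^+ 2); first by ring.
  rewrite e2 e1; transitivity (2 * (sq a *+ 2) ^+ 2 * Z); last by ring.
  by rewrite a2 /Z; ring.
apply/eqP; apply: contraT => /series_lead[k Zk] /eqP Z0; case: Z0.
have a2o : (8 * sq a ^+ 2) 0%N = (2 ^ 3)%:R by rewrite scoefM0 scoef_nat scoefX0 sq_coef0 a0 expr1n mulr1.
have := congr1 (fun s => scoef s (0 + k)%N) HZ; rewrite (ordge_lead (@ordge0 _ _) Zk) a2o add0n.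
case: k Zk => [|k] Zk.
  rewrite 2!scoefM0 scoef_nat scoefX0 sq_coef0 a0 expr1n !mulr1 /= => /eqP.
  rewrite -subr_eq0 -mulrBl mulf_eq0 => /orP[|/eqP//].
  rewrite -natrB // -[(_ - _)%N]/(3 * 2 ^ 3)%N natrM mulf_eq0 (negPf three_neq0).
  by rewrite (negPf (pow2_neq0 3)).
have H : ordge k.+2 (32 * a ^+ 2 * sq Z).
  by rewrite mulrC; apply/ordgeMl/(ordgeW _ (sq_ordge Zk)); lia.
by rewrite H // => /esym/eqP; rewrite mulf_eq0 (negPf (pow2_neq0 3)) => /eqP.
Qed.

Local Notation al := (a ^+ 2).
Local Notation be := (b ^+ 2).

Lemma al_unit : al \is a GRing.unit. Proof. by rewrite unitrX // a_unit. Qed.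
Lemma be_unit : be \is a GRing.unit. Proof. by rewrite unitrX // b_unit. Qed.

Lemma qder_be : al * D be = be * D al - al * be * (al - be).
Proof.
rewrite !qderX /=; apply/eqP; rewrite -subr_eq0 -[X in _ == X](mulr0 (a * b)) -qder_ratio.
by apply/eqP; ring.
Qed.

Variables t tn v : S.
Hypothesis Ha : a = tn ^+ 2.
Hypothesis Hb : b = t ^+ 2.
Hypothesis t_tn : t * tn = sq t ^+ 2.
Hypothesis tv_sq : t * v ^+ 2 = sq t * sq v.
Hypothesis v0E : v 0%N = 1.

(* Both sides are solutions of y^2 = 16 y(q^2) al(q^2) with leading term 16 q. *)
Lemma al_sub_be : al - be = 16 * q * be * v ^+ 8 * sq v ^+ 8.
Proof.
set s := LHS; set s' := RHS.
have Hs : s ^+ 2 = 16 * sq s * sq al.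
  rewrite /s !(rmorphB, rmorphXn) /=.
  transitivity ((sq a *+ 2) ^+ 2 * ((sq a *+ 2) ^+ 2 - 4 * sq b ^+ 2)); last by ring.
  by rewrite a2 -ab; ring.
have Hs' : s' ^+ 2 = 16 * sq s' * sq al.
  rewrite /s' !(rmorphM, rmorphXn, rmorph_nat) /= sq_qvar.
  transitivity (256 * q ^+ 2 * (t * v ^+ 2) ^+ 8 * sq v ^+ 16).
    by rewrite Hb; ring.
  rewrite tv_sq.
  transitivity (256 * q ^+ 2 * (sq t * sq v ^+ 2) ^+ 8 * sq v ^+ 8); first by ring.
  rewrite (_ : sq t * sq v ^+ 2 = sq (t * v ^+ 2)); last by rewrite rmorphM rmorphXn.
  rewrite tv_sq rmorphM /=.
  transitivity (256 * q ^+ 2 * sq (sq t) ^+ 8 * sq v ^+ 8 * sq (sq v) ^+ 8); first by ring.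
  have -> : sq (sq t) ^+ 8 = sq be * sq al.
    by rewrite -rmorphM /= -exprMn [b * a]mulrC ab Hb !rmorphXn /=; ring.
  ring.
have al0 : al 0%N = 1 by rewrite scoefX0 a0 expr1n.
have be0 : be 0%N = 1 by rewrite scoefX0 b0 expr1n.
have al1 : al 1%N = 8 by rewrite expr2 scoefM1 a0 a1; ring.
have be1 : be 1%N = - 8 by rewrite expr2 scoefM1 b0 b1; ring.
have so : ordge 1 s by case=> // _; rewrite scoefB al0 be0 subrr.
have s'E : s' = q ^+ 1 * (16 * be * v ^+ 8 * sq v ^+ 8) by rewrite /s' expr1; ring.
have s'o : ordge 1 s' by rewrite s'E; apply/ordgeMl/ordge_qX.
have s'1 : s' 1%N = (2 ^ 4)%:R.
  by rewrite s'E scoef_qXM subnn 3!scoefM0 scoef_nat !scoefX0 sq_coef0 v0E b0 !expr1n !mulr1.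
have s1 : s 1%N = (2 ^ 4)%:R by rewrite scoefB al1 be1; ring.
apply/eqP; rewrite -subr_eq0; set Z := s - s'.
apply: contraT => /series_lead[k Zk] /eqP Z0; case: Z0.
(* Eliminating al(q^2) from the two quadratic equations. If Z has order k, the left side has order k
   + 3 with leading factor 32 * 16, and the right side has order at least 2k + 2; this excludes k >=
   2, and the coefficients of q^0 and q^1 agree. *)
have HZ : Z * ((s + s') * sq s') = s' ^+ 2 * sq Z.
  apply/eqP; rewrite -subr_eq0; apply/eqP.
  transitivity (s ^+ 2 * sq s' - s' ^+ 2 * sq s); first by rewrite /Z rmorphB; ring.
  by rewrite Hs Hs'; ring.
case: k Zk => [|[|k]] Zk.
- by rewrite /Z scoefB so // s'o // subrr.
- by rewrite /Z scoefB s1 s'1 subrr.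
have H1 : ordge (1 + 2) ((s + s') * sq s') by apply: ordgeM (ordgeD so s'o) (sq_ordge s'o).
have := congr1 (fun z => scoef z (k.+2 + (1 + 2))%N) HZ; rewrite (ordge_lead Zk H1).
rewrite (ordge_lead (ordgeD so s'o) (sq_ordge s'o)).
rewrite scoefD s1 s'1 -[2%N]/(1.*2) sq_even s'1.
have H2 : ordge (2 * 1 + k.+2.*2) (s' ^+ 2 * sq Z) by apply: ordgeM (ordgeX s'o) (sq_ordge Zk).
rewrite H2; last by lia.
move/eqP; rewrite mulf_eq0 => /orP[/eqP //|].
rewrite -natrD -[(_ + _)%N]/(2 ^ 5)%N mulf_eq0 (negPf (pow2_neq0 4)) (negPf (pow2_neq0 5)) //.
Qed.

(** [al_sub_be] and [E1] express v^24 by q, al and be, which gives f^24 (al - be) al = 16 q be^8;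
    then logarithmic differentiation. The isolated term al on the right comes from the factor q. *)
Lemma qder_f f : f * v = t ->
  24 * al * D f = f * (al + 6 * D al - 8 * al ^+ 2 + 7 * al * be).
Proof.
move=> ft;
have v0 : v != 0 by apply/eqP => H; move/esym/eqP: v0E; rewrite H oner_eq0.
have t0 : t != 0.
  by apply/eqP => H; move/esym/eqP: b0; rewrite Hb H expr2 mulr0 oner_eq0.
have f0 : f != 0 by apply: contra_neq t0 => f0; rewrite -ft f0 mul0r.
have al0 : al != 0 by apply: contraTneq al_unit => ->; rewrite unitr0.
have be0 : be != 0 by apply: contraTneq be_unit => ->; rewrite unitr0.
have E1 : al * sq v ^+ 8 = be * v ^+ 16.
  apply: (mulfI (expf_neq0 4 t0)).
  transitivity ((sq t * sq v) ^+ 8); last by rewrite -tv_sq Hb; ring.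
  transitivity ((t * tn) ^+ 4 * sq v ^+ 8); first by rewrite Ha; ring.
  by rewrite t_tn; ring.
have Hf : f ^+ 24 * (al - be) * al = 16 * q * be ^+ 8.
  apply: (mulIf (expf_neq0 24 v0)).
  transitivity ((f * v) ^+ 24 * (al - be) * al); first by ring.
  rewrite ft al_sub_be.
  transitivity (16 * q * be ^+ 7 * v ^+ 8 * (al * sq v ^+ 8)); last by rewrite E1; ring.
  by rewrite Hb; ring.
have s0 : al - be != 0.
  apply: contra_neq (qvar_neq0 F) => s0; move: Hf; rewrite s0 mulr0 mul0r => /esym/eqP.
  rewrite mulf_eq0 (negPf (expf_neq0 _ be0)) orbF mulf_eq0 => /orP[|/eqP//].
  move/eqP/(congr1 (fun s => scoef s 0)); rewrite scoef_nat scoef0 /= => /eqP.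
  by rewrite (negPf (pow2_neq0 4)).
have HD := congr1 D Hf; rewrite !(qderM, qderB, qderX, qder_nat, qder_qvar) /= in HD.
set s := al - be in s0 *.
apply: (mulIf (mulf_neq0 (mulf_neq0 al0 be0) s0)).
apply: (mulfI (expf_neq0 23 f0)).
transitivity (24 * f ^+ 23 * D f * s * al * (be * al)); first by ring.
have -> : 24 * f ^+ 23 * D f * s * al =
  16 * q * be ^+ 8 + 16 * q * (8 * be ^+ 7 * D be) - f ^+ 24 * (D al - D be) * al - f ^+ 24 * s * D al.
  by apply/eqP; rewrite -subr_eq0; move/eqP: HD; rewrite -subr_eq0 => /eqP <-; apply/eqP; rewrite /s !qderX; ring.
transitivity ((16 * q * be ^+ 8) * (be * al + 8 * (al * D be))
   - f ^+ 24 * al * be * (al * D al - al * D be + s * D al)); first by ring.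
by rewrite qder_be -Hf /s; ring.
Qed.

End AGM.

End Differential.

(** * The Hasse polynomial *)

Section PolyEval.
Variable F : fieldType.
Local Notation S := (series F).
Implicit Types (x : S) (P Q : {poly F}).

Definition pev x : {poly F} -> S :=
  horner_morph (fun c => mulrC x (sconst c)).
HB.instance Definition _ x := GRing.RMorphism.on (pev x).

Lemma pevX x : pev x 'X = x. Proof. exact: horner_morphX. Qed.
Lemma pevC x c : pev x c%:P = sconst c. Proof. exact: horner_morphC. Qed.
Lemma pevZ x c P : pev x (c *: P) = sconst c * pev x P.
Proof. by rewrite -mul_polyC rmorphM /= pevC. Qed.

Lemma pev_cons x P c : pev x (P * 'X + c%:P) = pev x P * x + sconst c.
Proof. by rewrite rmorphD rmorphM /= pevX pevC. Qed.

Lemma qder_pev x P : qder (pev x P) = pev x P^`() * qder x.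
Proof.
elim/poly_ind: P => [|P c IH]; first by rewrite deriv0 !rmorph0 mul0r qder0.
rewrite pev_cons derivD derivC addr0 derivM derivX mulr1 rmorphD rmorphM /= pevX.
by rewrite qderD qder_const addr0 qderM IH; ring.
Qed.

Lemma pev_coef0 x P : pev x P 0%N = P.[x 0%N].
Proof.
elim/poly_ind: P => [|P c IH]; first by rewrite rmorph0 horner0.
by rewrite pev_cons scoefD scoefM0 IH !hornerE.
Qed.

Lemma pev_comp x P Q : pev x (P \Po Q) = pev (pev x Q) P.
Proof.
elim/poly_ind: P => [|P c IH]; first by rewrite comp_poly0 !rmorph0.
by rewrite comp_polyD comp_polyM comp_polyX comp_polyC pev_cons rmorphD rmorphM /= IH pevC.
Qed.

(** Split P as Q (X - x(0))^k with Q(x(0)) nonzero: Q(x) has a nonzero constant term, and x - x(0)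
    is nonzero because of its coefficient of q. *)
Lemma pev_eq0 x P : x 1%N != 0 -> pev x P = 0 -> P = 0.
Proof.
move=> x1 H; apply/eqP; apply: contraT => P0.
have [k [Q /implyP/(_ P0) Q0 E]] := multiplicity_XsubC P (x 0%N).
move: H; rewrite E rmorphM rmorphXn rmorphB /= pevX pevC => /eqP; rewrite mulf_eq0 => /orP[].
  move/eqP/(congr1 (fun s => scoef s 0)); rewrite pev_coef0 scoef0 => /eqP Qr.
  by case/negP: Q0.
rewrite expf_eq0 => /andP[_ /eqP/(congr1 (fun s => scoef s 1%N))].
by rewrite scoefB /= subr0 => /eqP; rewrite (negPf x1).
Qed.

Lemma pev_inj x : x 1%N != 0 -> injective (pev x).
Proof.
move=> x1 P Q PQ; apply/eqP; rewrite -subr_eq0; apply/eqP/(pev_eq0 x1).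
by rewrite rmorphB /= PQ subrr.
Qed.

End PolyEval.

Section CharP.
Variables (F : fieldType) (l m : nat).
Hypothesis charF : l \in [pchar F].
Hypothesis lE : l = m.*2.+1.
Hypothesis l_ge5 : (5 <= l)%N.

Lemma natF_eq0 n : (n%:R == 0 :> F) = (l %| n)%N.
Proof. by rewrite (dvdn_pcharf charF). Qed.

Lemma natF_neq0 n : (0 < n < l)%N -> n%:R != 0 :> F.
Proof. by case/andP=> n0 nl; rewrite natF_eq0 gtnNdvd. Qed.

Lemma pchar_prime : prime l. Proof. by case/andP: charF. Qed.

Lemma pchar_neq2 : 2%:R != 0 :> F. Proof. by apply: natF_neq0; lia. Qed.
Lemma pchar_neq3 : 3%:R != 0 :> F. Proof. by apply: natF_neq0; lia. Qed.

Lemma two_half : (2 * m%:R + 1 = 0 :> F).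
Proof.
rewrite -(natrM _ 2) natr1; apply/eqP.
by rewrite natF_eq0 mul2n lE.
Qed.

(* The Hasse polynomial of the Legendre family of elliptic curves, up to sign. *)
Definition hasse : {poly F} := \poly_(i < m.+1) ('C(m, i) ^ 2)%:R.
Local Notation A := hasse.
Definition nu : {poly F} := 'X^2 - 'X.

Lemma coef_hasse i : A`_i = ('C(m, i) ^ 2)%:R.
Proof.
rewrite coef_poly; case: ltnP => // mi.
by rewrite bin_small.
Qed.

Lemma size_hasse : size A = m.+1.
Proof. by rewrite size_poly_eq //= binn oner_eq0. Qed.

Lemma hasse0 : A.[0] = 1.
Proof. by rewrite horner_coef0 coef_hasse bin0. Qed.

Lemma hasse_neq0 : A != 0.
Proof. by rewrite -size_poly_eq0 size_hasse. Qed.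

(** The hypergeometric equation with parameters 1/2, 1/2, 1. The recurrence (i+1)^2 C(m,i+1)^2 =
    (m-i)^2 C(m,i)^2 turns the difference of the coefficients of X^i into a multiple of 2m + 1 = l:
    m takes the place of -1/2. *)
Lemma hasse_ode : (nu * A^`())^`() *+ 4 = - A.
Proof.
apply/polyP => i; rewrite coefMn coefN coef_deriv /nu mulrBl expr2 -mulrA coefB !coefXM /=.
rewrite !coef_deriv !coef_hasse.
have -> : (if i == 0%N then 0 else ('C(m, i.-1.+1) ^ 2)%:R *+ i.-1.+1) =
    i%:R * ('C(m, i) ^ 2)%:R :> F.
  by case: i => [|i] /=; rewrite ?mul0r // mulr_natl.
have [mi|im] := ltnP m i.
  by rewrite !bin_small ?(ltnW mi) //; first ring; rewrite ltnS ltnW.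
have H : ('C(m, i.+1) ^ 2)%:R * i.+1%:R ^+ 2 = ('C(m, i) ^ 2)%:R * (m%:R - i%:R) ^+ 2 :> F.
  rewrite -natrB // !natrX -!exprMn -!natrM; congr (_%:R ^+ 2).
  by rewrite mulnC mul_bin_left mulnC.
set C := ('C(m, i) ^ 2)%:R in H *; set C1 := ('C(m, i.+1) ^ 2)%:R in H *.
transitivity (4%:R * (i.+1%:R * i%:R * C - C1 * i.+1%:R ^+ 2)); first by ring.
rewrite H -natr1; apply/eqP; rewrite -subr_eq0; apply/eqP.
set M : F := m%:R; set I : F := i%:R.
transitivity (- C * (2 * M + 1) * (2 * M - 1 - 4 * I)); first by ring.
by rewrite two_half mulr0 mul0r.
Qed.

(** Let k be the multiplicity of z and Q the cofactor. The lowest term of [hasse_ode] at z is 4 k^2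
    Q(z) if z = 1 and 4 nu(z) k (k-1) Q(z) if z is neither 0 nor 1. As k < l, a root is therefore
    different from 1 and simple; 0 is excluded by A(0) = 1. After the case analysis, the variable k
    stands for the multiplicity minus one, then minus two. *)
Lemma hasse_root z : root A z -> [/\ z != 0, z != 1 & A^`().[z] != 0].
Proof.
move=> Az; have z0 : z != 0.
  by apply: contraTneq Az => ->; rewrite /root hasse0 oner_eq0.
have [k [Q /implyP/(_ hasse_neq0) Qz E]] := multiplicity_XsubC A z.
set Y := 'X - z%:P in E.
have YE : Y = 'X - z%:P by [].
have Yz : Y.[z] = 0 by rewrite !hornerE subrr.
have dY : Y^`() = 1 by rewrite derivB derivX derivC subr0.
have Q0 : Q != 0 by apply: contraNneq Qz => ->; rewrite root0.
have kl : (k < l)%N.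
  have : size A = m.+1 by exact: size_hasse.
  rewrite E size_Mmonic ?monicX ?monicXn ?monic_exp ?monicXsubC // size_exp_XsubC.
  have := Q0; rewrite -size_poly_gt0 lE; lia.
have k0 : (0 < k)%N.
  by rewrite lt0n; apply: contraTneq Az => k0; rewrite E k0 expr0 mulr1.
have Y0 : Y != 0 by rewrite polyXsubC_eq0.
have h1 : (1 : {poly F}).[z] = 1 by exact: hornerC.
clearbody Y; case: k => // k in E kl k0 *.
have dA : A^`() = (Q^`() * Y + k.+1%:R * Q) * Y ^+ k.
  by rewrite E derivM deriv_exp dY mul1r exprS /= -mulr_natl; ring.
have ode := hasse_ode.
have z1 : z != 1.
  apply: contraNneq Qz => z1.
  have nuE : nu = 'X * Y by rewrite /nu YE z1; ring.
  move: ode; rewrite nuE dA.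
  have -> : 'X * Y * ((Q^`() * Y + k.+1%:R * Q) * Y ^+ k) = 'X * (Q^`() * Y + k.+1%:R * Q) * Y ^+ k.+1.
    by rewrite exprS; ring.
  rewrite derivM deriv_exp dY mul1r /= E exprS => ode.
  have {ode} ode : ((( 'X * (Q^`() * Y + k.+1%:R * Q))^`() * Y + 'X * (Q^`() * Y + k.+1%:R * Q) *+ k.+1) *+ 4 + Q * Y) * Y ^+ k = 0.
    apply/eqP; rewrite -[X in _ == X](subrr (Q * (Y * Y ^+ k))).
    by rewrite -[X in _ == _ + X]ode; apply/eqP; ring.
  move/eqP: ode; rewrite mulf_eq0 expf_eq0 (negPf Y0) andbF orbF => /eqP/(congr1 (horner^~ z)).
  set U := _^`(); rewrite !(hornerMn, hornerD, hornerM, hornerX) Yz h1 horner0.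
  have -> : (U.[z] * 0 + z * (Q^`().[z] * 0 + 1 *+ k.+1 * Q.[z]) *+ k.+1) *+ 4 + Q.[z] * 0
     = (2 ^ 2)%:R * z * k.+1%:R ^+ 2 * Q.[z] by ring.
  have F4 : (2 ^ 2)%:R != 0 :> F by rewrite natrX expf_neq0 // pchar_neq2.
  have Fk : k.+1%:R != 0 :> F by apply: natF_neq0; rewrite kl.
  by move/eqP; apply: contraTT => Qz'; exact: mulf_neq0 (mulf_neq0 (mulf_neq0 F4 z0) (expf_neq0 2 Fk)) Qz'.
split=> //; case: k => [|k] in E kl k0 dA *.
  by rewrite dA expr0 mulr1 !(hornerMn, hornerD, hornerM) Yz h1 mulr0 add0r mul1r.
have nuz : nu.[z] != 0.
  have -> : nu.[z] = z * (z - 1) by rewrite !hornerE; ring.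
  by rewrite mulf_neq0 // subr_eq0.
exfalso; move: ode nuz; rewrite dA; move: (nu) => n ode nuz; move: ode.
have -> : n * ((Q^`() * Y + k.+2%:R * Q) * Y ^+ k.+1) = n * (Q^`() * Y + k.+2%:R * Q) * Y ^+ k.+1.
  by ring.
rewrite derivM deriv_exp dY mul1r /= E !exprS => ode.
have {ode} ode : ((( n * (Q^`() * Y + k.+2%:R * Q))^`() * Y + n * (Q^`() * Y + k.+2%:R * Q) *+ k.+1) *+ 4 + Q * Y * Y) * Y ^+ k = 0.
  apply/eqP; rewrite -[X in _ == X](subrr (Q * (Y * (Y * Y ^+ k)))).
  by rewrite -[X in _ == _ + X]ode; apply/eqP; ring.
move/eqP: ode; rewrite mulf_eq0 expf_eq0 (negPf Y0) andbF orbF => /eqP/(congr1 (horner^~ z)).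
set U := _^`(); rewrite !(hornerMn, hornerD, hornerM, hornerX) Yz h1 horner0.
have -> : (U.[z] * 0 + n.[z] * (Q^`().[z] * 0 + 1 *+ k.+2 * Q.[z]) *+ k.+1) *+ 4 + Q.[z] * 0 * 0
   = (2 ^ 2)%:R * n.[z] * k.+1%:R * k.+2%:R * Q.[z] by ring.
have F4 : (2 ^ 2)%:R != 0 :> F by rewrite natrX expf_neq0 // pchar_neq2.
have Fk : k.+1%:R != 0 :> F by apply: natF_neq0; rewrite (ltnW kl).
have Fk2 : k.+2%:R != 0 :> F by apply: natF_neq0; rewrite kl.
by apply/eqP; exact: mulf_neq0 (mulf_neq0 (mulf_neq0 (mulf_neq0 F4 nuz) Fk) Fk2) Qz.
Qed.

End CharP.

(** * Constancy of al^m A(x) *)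

Section CharP.
Variables (F : fieldType) (l m : nat).
Hypothesis charF : l \in [pchar F].
Hypothesis lE : l = m.*2.+1.
Hypothesis l_ge5 : (5 <= l)%N.
Local Notation A := (hasse F m).
Local Notation S := (series F).
Local Notation D := (@qder F).

(** The difference Z = Q - cP vanishes at 0 and still satisfies P Z' = Z P'. If its order at 0 is k
    > 0, the lowest coefficient of this equation is k P(0) times a nonzero constant, and k < l by
    the degree bounds. The bounds matter: P = 1, Q = X^l has zero Wronskian. *)
Lemma wronskian_poly (P Q : {poly F}) :
  (size P <= l)%N -> (size Q <= l)%N -> P.[0] != 0 -> P * Q^`() = Q * P^`() ->
  Q = (Q.[0] / P.[0]) *: P.
Proof.
move=> sP sQ P0 PQ; apply/eqP; rewrite -subr_eq0; set c := _ / _; set Z := _ - _.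
apply: contraT => Z0.
have ZP : P * Z^`() = Z * P^`() by rewrite /Z derivB derivZ -!mul_polyC; ring: PQ.
have Zr : root Z 0 by rewrite /root !hornerE /c divfK // subrr.
have [k [Q1 /implyP/(_ Z0) Q1z E]] := multiplicity_XsubC Z 0.
rewrite subr0 in E.
have Q10 : Q1 != 0 by apply: contraNneq Q1z => ->; rewrite root0.
have kl : (k < l)%N.
  have sZ : (size Z <= l)%N.
    by rewrite /Z (leq_trans (size_polyD _ _)) // geq_max sQ size_polyN (leq_trans (size_scale_leq _ _)).
  move: sZ; rewrite E size_Mmonic ?monicXn // size_polyXn.
  by have := Q10; rewrite -size_poly_gt0; lia.
case: k => [|k] in E kl *; first by case/negP: Q1z; rewrite -[Q1]mulr1 -(expr0 'X) -E.
have : (P * (Q1^`() * 'X + k.+1%:R * Q1) - Q1 * 'X * P^`()) * 'X^k = 0.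
  apply/eqP; rewrite -[X in _ == X](subrr (P * Z^`())) {2}ZP E derivM derivXn exprS /= -mulr_natl.
  by apply/eqP; ring.
move/eqP; rewrite mulf_eq0 expf_eq0 polyX_eq0 andbF orbF => /eqP/(congr1 (horner^~ 0)).
rewrite !(hornerD, hornerM, hornerN, hornerMn, hornerX) hornerC horner0 !(mulr0, mul0r) add0r subr0.
move/eqP; rewrite !mulf_eq0 (negPf P0) /= (negPf (natF_neq0 charF _)) ?kl //=.
by rewrite -[_ == 0]/(root Q1 0) (negPf Q1z).
Qed.

Lemma pcharS : l \in [pchar (series F)].
Proof.
rewrite inE (pchar_prime charF) /=; apply/eqP/seriesP => n; rewrite scoef_nat scoef0.
by case: ifP => // _; apply/eqP; rewrite (natF_eq0 charF).
Qed.

Lemma hasse1_neq0 : A.[1] != 0.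
Proof.
by apply/negP => /(hasse_root charF lE)[//|_ /eqP].
Qed.

Variables a b : S.
Hypothesis ab : a * b = sq b ^+ 2.
Hypothesis a2 : sq a *+ 2 = a + b.
Hypotheses (a0 : a 0%N = 1) (b0 : b 0%N = 1) (a1 : a 1%N = 4) (b1 : b 1%N = - 4).
Local Notation al := (a ^+ 2).
Local Notation be := (b ^+ 2).

Let x : S := be / al.
Let r : S := b / a.

Lemma two_neq0 : 2%:R != 0 :> F. Proof. exact: pchar_neq2 charF lE l_ge5. Qed.
Lemma three_neq0 : 3%:R != 0 :> F. Proof. exact: pchar_neq3 charF lE l_ge5. Qed.

Lemma a_unitS : a \is a GRing.unit. Proof. exact: a_unit. Qed.
Lemma al_unitS : al \is a GRing.unit. Proof. exact: al_unit. Qed.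
Lemma a_neq0 : a != 0. Proof. by apply: contraTneq a_unitS => ->; rewrite unitr0. Qed.

Lemma x_mul_al : x * al = be. Proof. exact: divrK al_unitS _. Qed.
Lemma r_mul_a : r * a = b. Proof. exact: divrK a_unitS _. Qed.
Lemma x_sqr_r : x = r ^+ 2.
Proof. by apply: (mulIr al_unitS); rewrite x_mul_al -exprMn r_mul_a. Qed.

Lemma r_coef0 : r 0%N = 1.
Proof. by have := congr1 (fun s => scoef s 0) r_mul_a; rewrite scoefM0 a0 b0 mulr1. Qed.
Lemma r_coef1 : r 1%N = - 8.
Proof.
have := congr1 (fun s => scoef s 1%N) r_mul_a; rewrite scoefM1 a0 a1 b1 r_coef0 => H.
by transitivity (1 * 4 + r 1%N * 1 - 4); [ring | rewrite H; ring].
Qed.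
Lemma eight_neq0 : - 8 != 0 :> F.
Proof. by rewrite oppr_eq0 -[8%N]/(2 ^ 3)%N natrX expf_neq0 // two_neq0. Qed.
Lemma r1_neq0 : r 1%N != 0. Proof. by rewrite r_coef1 eight_neq0. Qed.
Lemma x_coef0 : x 0%N = 1. Proof. by rewrite x_sqr_r scoefX0 r_coef0 expr1n. Qed.
Lemma x1_neq0 : x 1%N != 0.
Proof.
rewrite x_sqr_r expr2 scoefM1 r_coef0 mulr1 mul1r -mulr2n -mulr_natl mulf_neq0 ?two_neq0 //.
exact: r1_neq0.
Qed.

Lemma qder_x : D x = pev x (nu F) * al.
Proof.
apply: (mulIr (unitrX 2 al_unitS)).
have := qder_be two_neq0 three_neq0 ab a2 a0 b0 a1 b1 => H.
have H2 := congr1 D x_mul_al; rewrite qderM in H2.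
rewrite /nu rmorphB rmorphXn /= pevX.
transitivity (al * (D x * al + x * D al) - x * al * D al); first by ring.
by rewrite H2 H -x_mul_al; ring.
Qed.

Let y := pev x A.

(* y = A(x) and a solve the same second-order equation, so their Wronskian shows
   that D (D (y / a)) = 0; in characteristic l this is D (y / a) = 0. *)
Lemma qder_ya : D (y / a) = 0.
Proof.
set c := y / a.
have ca : c * a = y by rewrite divrK // a_unitS.
clearbody c.
have E1 : D c * a + c * D a = pev x (nu F * A^`()) * al.
  by rewrite -qderM ca /y qder_pev qder_x rmorphM /=; ring.
have E2 := congr1 D E1.
have ode := congr1 (pev x) (hasse_ode charF lE); rewrite rmorphMn rmorphN /= -/y in ode.
have H := qder2_a two_neq0 three_neq0 ab a2 a0 b0 a1 b1.
rewrite !(qderD, qderM, qderX) qder_pev qder_x /= in E2.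
set g := pev x (nu F * _) in E1 E2; set g' := pev x _ in ode E2.
have : 4 * a ^+ 3 * D (D c) = 0.
  have e2 : a ^+ 2 * D (D c) = a * (g' * (pev x (nu F) * al) * al + g * (2 * a * D a)) - 2 * a * D c * D a - (c * a) * D (D a).
    transitivity (a * (D (D c) * a + D c * D a + (D c * D a + c * D (D a))) - 2 * a * D c * D a - (c * a) * D (D a)); first by ring.
    by rewrite E2; ring.
  transitivity (4 * a * (a ^+ 2 * D (D c))); first by ring.
  rewrite e2.
  transitivity ((g' *+ 4) * pev x (nu F) * al ^+ 3 + 8 * a ^+ 3 * g * D a - 8 * a * D a * (D c * a) - 4 * a * (c * a) * D (D a)); first by ring.
  have -> : D c * a = g * al - c * D a by rewrite -E1; ring.
  rewrite ode ca /nu rmorphB rmorphXn /= pevX.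
  transitivity (y * ((x * al) * (al - x * al) * al - 4 * (a * D (D a) - 2 * D a ^+ 2))
      - 8 * D a ^+ 2 * y + 8 * D a ^+ 2 * (c * a)); first by ring.
  by rewrite x_mul_al H ca; ring.
move/eqP; rewrite mulf_eq0 mulf_eq0 (negPf (expf_neq0 _ a_neq0)) orbF => /orP[/eqP H4|/eqP DDc].
  have := congr1 (fun s => scoef s 0) H4; rewrite scoef_nat /= => /eqP.
  by rewrite -[4%N]/(2 * 2)%N natrM mulf_eq0 (negPf two_neq0).
apply: seriesP => n; have := congr1 (fun s => scoef s n) DDc; rewrite /= => /eqP.
by rewrite mulf_eq0 => /orP[/eqP ->|/eqP //]; rewrite mul0r.
Qed.

Let W := al ^+ m * y.

(** As l = 2m + 1, al^m y is a^l (y / a), and D kills l-th powers. *)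
Lemma qder_W : D W = 0.
Proof.
have -> : W = a ^+ l * (y / a).
  by rewrite /W lE (exprS _ m.*2) -mul2n exprM -{1}(divrK a_unitS y); ring.
rewrite qderM qder_ya mulr0 addr0 qderX.
by rewrite (pcharf0 pcharS) !mul0r.
Qed.

Lemma qder_sqW : D (sq W) = 0.
Proof. by rewrite qder_sq qder_W rmorph0 mul0rn. Qed.

(* W and W(q^2) are a^(2m) Y1(r) and a^(2m) Y2(r) for polynomials of degree < l in
   r = b/a; since both are killed by D, Y1 and Y2 are proportional. *)
Lemma W_const : W = sconst A.[1].
Proof.
pose h : F := 2^-1.
pose Y1 : {poly F} := A \Po 'X^2.
(* By x(q^2) al(q^2) = a b and a(q^2) = (a + b)/2, W(q^2) is a form of degree 2m in a and b.
   Dividing it by a^(2m) leaves this polynomial in r = b/a, of degree at most 2m = l - 1. *)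
pose Y2 : {poly F} := \sum_(i < m.+1) A`_i *: ('X^i * (h *: ('X + 1)) ^+ (m - i).*2).
have hh : sconst h *+ 2 = 1.
  by rewrite -rmorphMn /= /h -mulr_natl mulfV ?two_neq0 // rmorph1.
have a2E : sq a = sconst h * (a + b) by rewrite -a2 mulrnAr -mulrnAl hh mul1r.
have W1 : W = a ^+ m.*2 * pev r Y1.
  by rewrite /W /y x_sqr_r /Y1 pev_comp rmorphXn /= pevX -mul2n exprM; ring.
have pevE z : pev z A = \sum_(i < m.+1) sconst A`_i * z ^+ i.
  rewrite -{1}[A]coefK size_hasse poly_def rmorph_sum /=; apply: eq_bigr => i _.
  by rewrite pevZ rmorphXn /= pevX.
have W2 : sq W = a ^+ m.*2 * pev r Y2.
  have -> : sq W = \sum_(i < m.+1) sconst A`_i * ((a * b) ^+ i * sq a ^+ (m - i).*2).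
    rewrite /W /y pevE mulr_sumr rmorph_sum /=; apply: eq_bigr => i _.
    rewrite !rmorphM /= sq_const mulrCA; congr (_ * _).
    have im : (i <= m)%N by rewrite -ltnS.
    have sx : sq x * sq al = a * b by rewrite -rmorphM /= x_mul_al ab rmorphXn.
    rewrite -sx -{1}(subnK im) !rmorphXn /= exprD -mul2n exprM !exprMn.
    by ring.
  rewrite rmorph_sum /= mulr_sumr; apply: eq_bigr => i _.
  have im : (i <= m)%N by rewrite -ltnS.
  have -> : pev r (A`_i *: ('X^i * (h *: ('X + 1)) ^+ (m - i).*2)) =
      sconst A`_i * (r ^+ i * (sconst h * (r + 1)) ^+ (m - i).*2).
    by rewrite pevZ rmorphM !rmorphXn /= pevX pevZ rmorphD rmorph1 /= pevX.
  rewrite a2E (_ : sconst h * (a + b) = a * (sconst h * (r + 1))); last by rewrite -r_mul_a; ring.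
  rewrite (_ : a * b = a ^+ 2 * r); last by rewrite -r_mul_a; ring.
  have -> : a ^+ m.*2 = (a ^+ 2) ^+ i * a ^+ (m - i).*2.
    by rewrite -exprM -exprD mul2n -doubleD subnKC.
  by rewrite !exprMn; ring.
have Dr0 : D r != 0.
  apply: contraNneq r1_neq0 => /(congr1 (fun s => scoef s 1%N)).
  by rewrite /= mul1r => ->.
have Wr : Y1 * Y2^`() = Y2 * Y1^`().
  apply: (pev_inj r1_neq0); apply: (mulIf Dr0).
  apply: (mulfI (expf_neq0 m.*2 a_neq0)); apply: (mulfI (expf_neq0 m.*2 a_neq0)).
  rewrite !rmorphM /=; set E := a ^+ m.*2.
  have D1 := qder_W; have D2 := qder_sqW; rewrite W1 qderM qder_pev -/E in D1.
  rewrite W2 qderM qder_pev -/E in D2.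
  transitivity (E * pev r Y1 * (D E * pev r Y2 + E * (pev r Y2^`() * D r)) - D E * E * pev r Y1 * pev r Y2).
    by ring.
  rewrite D2.
  transitivity (E * pev r Y2 * (D E * pev r Y1 + E * (pev r Y1^`() * D r)) - D E * E * pev r Y1 * pev r Y2).
    by rewrite D1; ring.
  by ring.
have s1 : (size Y1 <= l)%N.
  apply: leq_trans (size_comp_poly_leq _ _) _.
  by rewrite size_hasse size_polyXn lE /=; lia.
have s2 : (size Y2 <= l)%N.
  apply: leq_trans (size_sum _ _ _) _; apply/bigmax_leqP => i _.
  apply: leq_trans (size_scale_leq _ _) _; apply: leq_trans (size_polyMleq _ _) _.
  rewrite size_polyXn.
  have := size_poly_exp_leq (h *: ('X + 1)) (m - i).*2.
  have sp : ((size (h *: ('X + 1) : {poly F})).-1 <= 1)%N.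
    by rewrite -subn1 leq_subLR (leq_trans (size_scale_leq _ _)) // -[1]/(1%:P) size_XaddC.
  have := leq_mul sp (leqnn (m - i).*2); have := ltn_ord i; rewrite lE mul1n.
  move: (size _).-1 => u; set s := size (_ ^+ _ : {poly F}).
  by move: s (u * _)%N => s k; lia.
have Y10 : Y1.[0] = 1 by rewrite horner_comp hornerXn expr0n hasse0.
have Y2E := wronskian_poly s1 s2 _ Wr.
rewrite Y10 oner_eq0 divr1 in Y2E; have {}Y2E := Y2E isT.
have sW : sq W = sconst Y2.[0] * W by rewrite W2 {1}Y2E pevZ W1; ring.
have W0 : W 0%N = A.[1] by rewrite scoefM0 !scoefX0 a0 !expr1n mul1r pev_coef0 x_coef0.
have c1 : Y2.[0] = 1.
  have := congr1 (fun s => scoef s 0) sW; rewrite scoefZ sq_coef0 W0 => H.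
  by apply: (mulIf hasse1_neq0); rewrite -H mul1r.
rewrite c1 rmorph1 mul1r in sW.
by rewrite (sq_fixed sW) W0.
Qed.

End CharP.

(** * Independence of weights modulo l - 1 *)

Lemma double_cancel (m n0 n1 k0 k1 : nat) :
  (m.*2.+1 * n0 + m.*2.+2 * k0 + n1 = n0 + (m.*2.+1 * n1 + m.*2.+2 * k1))%N ->
  (n0 * m + (k0 * m + k0) = n1 * m + (k1 * m + k1))%N.
Proof.
rewrite !mulSn -!doubleMl ![(_ * m)%N]mulnC.
by move: (m * n0)%N (m * n1)%N (m * k0)%N (m * k1)%N => a b c d; lia.
Qed.

Section Grading.
Variables (F : fieldType) (l m : nat).
Hypothesis charF : l \in [pchar F].
Hypothesis lE : l = m.*2.+1.
Hypothesis l_ge5 : (5 <= l)%N.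
Local Notation A := (hasse F m).
Local Notation S := (series F).
Local Notation D := (@qder F).
Variables (K : closedFieldType) (iota : {rmorphism F -> K}).

Lemma charK : l \in [pchar K].
Proof. by rewrite (fmorph_pchar iota). Qed.

Lemma map_hasse : map_poly iota A = hasse K m.
Proof. by apply/polyP => i; rewrite coef_map /= !coef_hasse rmorph_nat. Qed.

Lemma hasse_coprime : coprimep A (nu F * A^`()).
Proof.
rewrite -(coprimep_map iota); apply/Pdiv.ClosedField.coprimepP => z.
rewrite map_hasse => /(hasse_root charK lE l_ge5)[z0 z1 dz].
rewrite rmorphM /= -deriv_map map_hasse /nu rmorphB rmorphXn /= map_polyX.
rewrite !hornerE !mulf_neq0 //.
rewrite (_ : _ - _ = z * (z - 1)); last by ring.
by rewrite mulf_neq0 // subr_eq0.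
Qed.

Lemma hasse_simple_root : exists2 z, root (hasse K m) z & mup z (hasse K m) = 1%N.
Proof.
have [z Az] : exists z, root (hasse K m) z.
  by apply/closed_rootP; rewrite size_hasse; lia.
exists z => //; have [_ _ dz] := hasse_root charK lE l_ge5 Az.
have A0 := hasse_neq0 K m.
apply/eqP; rewrite eqn_leq (mup_leq _ _ A0) (mup_geq _ _ A0) expr1 dvdp_XsubCl Az andbT.
apply/negP => /dvdpP[Q E]; case/eqP: dz; rewrite E derivM deriv_exp derivXsubC.
by rewrite !hornerE subrr /=; ring.
Qed.

Variables (x p : S) (w0 : F).
Hypothesis x1_neq0 : x 1%N != 0.
Hypothesis w0_neq0 : w0 != 0.
Hypothesis pA : p ^+ m * pev x A ^+ m.+1 = sconst w0.

Variable J : nat.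
Implicit Types c e : {ffun 'I_J -> {poly F}}.
Definition evp c : S := \sum_(j < J) pev x (c j) * p ^+ j.
Definition evpi i c : S := \sum_(j < J | j == i %[mod m]) pev x (c j) * p ^+ j.
Definition psupp c := [set j | c j != 0].

(** Squaring p^m A^(m+1) = w0 and multiplying by p gives p^l A^(l+1) = w0^2 p. Thus the l-th power
    of a relation in p, multiplied by A^((l+1)J), is again a relation with polynomial
    coefficients. *)
Lemma pA_frob j : p ^+ j ^+ l * pev x A ^+ (l.+1 * j) = sconst ((w0 ^+ 2) ^+ j) * p ^+ j.
Proof.
have H : p ^+ l * pev x A ^+ l.+1 = sconst (w0 ^+ 2) * p.
  rewrite rmorphXn /= -pA lE (exprS p) -(doubleS m) -!mul2n !(mulnC 2) !exprM; ring.
by rewrite -exprM mulnC exprM exprM -exprMn H exprMn [in RHS]rmorphXn.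
Qed.

(** At a simple root of A where c0, c1 have multiplicities n0, n1, the equation reads l n0 +
    (l+1)(J-j0) + n1 = n0 + l n1 + (l+1)(J-j). Since l - 1 = 2m, reducing modulo 2m leaves 2 j0 = 2
    j, that is j0 = j modulo m. *)
Lemma hasse_val (c0 c1 : {poly F}) (u0 u1 : F) j0 j : c0 != 0 -> c1 != 0 ->
  u0 != 0 -> u1 != 0 -> (j0 <= J)%N -> (j <= J)%N ->
  u0 *: c0 ^+ l * A ^+ (l.+1 * (J - j0)) * c1 =
  c0 * (u1 *: c1 ^+ l * A ^+ (l.+1 * (J - j))) -> j = j0 %[mod m].
Proof.
move=> c00 c10 u00 u10 j0J jJ /(congr1 (map_poly iota)).
rewrite !rmorphM /= !map_polyZ !rmorphXn /= map_hasse.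
set d0 := map_poly iota c0; set d1 := map_poly iota c1 => E.
have d00 : d0 != 0 by rewrite map_poly_eq0.
have d10 : d1 != 0 by rewrite map_poly_eq0.
have v00 : iota u0 != 0 by rewrite fmorph_eq0.
have v10 : iota u1 != 0 by rewrite fmorph_eq0.
have [z Az mz] := hasse_simple_root.
have A0 := hasse_neq0 K m.
have muX (P : {poly K}) n : P != 0 -> mup z (P ^+ n) = (n * mup z P)%N.
  move=> P0; elim: n => [|n IH]; last by rewrite exprS mupM ?expf_neq0 // IH mulSn.
  by rewrite expr0 mupNroot // root1.
have muZ (u : K) (P : {poly K}) : u != 0 -> P != 0 -> mup z (u *: P) = mup z P.
  move=> u0' P0; rewrite -mul_polyC mupMr // rootC //.
have := congr1 (mup z) E.
rewrite !mupM ?mulf_neq0 ?scaler_eq0 ?negb_or ?v00 ?v10 ?expf_neq0 // !muZ ?expf_neq0 //.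
rewrite !muX ?expf_neq0 // mz lE => H.
move: (mup z d0) (mup z d1) H => n0 n1.
have [k0 J0] : exists k0, J = (j0 + k0)%N by exists (J - j0)%N; rewrite subnKC.
have [k1 J1] : exists k1, J = (j + k1)%N by exists (J - j)%N; rewrite subnKC.
rewrite {1}J0 {1}J1 !addKn => H.
have {}H : (n0 * m + (k0 * m + k0) = n1 * m + (k1 * m + k1))%N.
  move: H; rewrite !muln1; exact: double_cancel.
have kk : k0 = k1 %[mod m].
  by have := congr1 (modn^~ m) H; rewrite !modnMDl.
apply/eqP; rewrite -(eqn_modDr k1) -J1 J0 eqn_modDl; exact/eqP.
Qed.

Lemma psupp_proper c e j0 : j0 \in psupp c -> e j0 = 0 ->
  (forall j, c j = 0 -> e j = 0) -> (#|psupp e| < #|psupp c|)%N.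
Proof.
move=> j0c ej0 H; apply: proper_card; apply/properP; split.
  by apply/subsetP => j; rewrite !inE; apply: contraNneq => /H ->.
by exists j0; rewrite // inE ej0 eqxx.
Qed.

Lemma evp_frob c : evp c = 0 ->
  evp [ffun j : 'I_J => (w0 ^+ 2) ^+ j *: c j ^+ l * A ^+ (l.+1 * (J - j))] = 0.
Proof.
move=> c0.
have : pFrobenius_aut (pcharS charF) (evp c) * pev x A ^+ (l.+1 * J) = 0.
  by rewrite c0 rmorph0 mul0r.
rewrite /evp rmorph_sum mulr_suml /= => H0; rewrite -[RHS]H0; apply: eq_bigr => j _.
rewrite ffunE -scalerAl pevZ rmorphM /= [pev x (c j ^+ l)]rmorphXn.
rewrite [pev x (A ^+ _)]rmorphXn /= pFrobenius_autE [(pev x (c j) * _) ^+ _]exprMn.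
have -> : (l.+1 * J = l.+1 * (J - j) + l.+1 * j)%N.
  by rewrite -mulnDr subnK // ltnW.
have := pA_frob j; rewrite exprD; move: (sconst _) => k H.
transitivity (pev x (c j) ^+ l * pev x A ^+ (l.+1 * (J - j)) * (k * p ^+ j)).
  by ring.
by rewrite -H; ring.
Qed.

(* In a relation of minimal support, raising to the l-th power gives a
   proportional relation; the valuation at a simple root of A then shows that all
   exponents agree modulo m. *)
Lemma evp_grading n c : (#|psupp c| <= n)%N -> evp c = 0 -> forall i, evpi i c = 0.
Proof.
elim: n c => [|n IH] c.
  rewrite leqn0 cards_eq0 => /eqP c0 _ i; apply: big1 => j _.
  have /eqP -> : c j == 0; last by rewrite rmorph0 mul0r.
  by have := in_set0 j; rewrite -c0 inE => /negbFE.
move=> cn c0 i.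
case: (set_0Vmem (psupp c)) => [s0|[j0 j0c]].
  by apply: (IH c) => //; rewrite s0 cards0.
have c0n : c j0 != 0 by rewrite inE in j0c.
case: (pselect (exists e, [/\ evp e = 0, (exists j, e j != 0) &
    exists2 k, k \in psupp c /\ e k = 0 & forall j, c j = 0 -> e j = 0])); last first.
  move=> noe; pose d := [ffun j : 'I_J => (w0 ^+ 2) ^+ j *: c j ^+ l * A ^+ (l.+1 * (J - j))].
  have d0 : evp d = 0 by apply: evp_frob.
  pose e := [ffun j : 'I_J => d j0 * c j - c j0 * d j].
  have e0 : evp e = 0.
    transitivity (pev x (d j0) * evp c - pev x (c j0) * evp d); last by rewrite c0 d0 !mulr0 subrr.
    rewrite /evp !mulr_sumr -sumrB; apply: eq_bigr => j _.
    by rewrite ffunE rmorphB !rmorphM /=; ring.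
  have eall j : e j = 0.
    apply/eqP; apply: contrapT => /negP ej; apply: noe; exists e; split=> //; first by exists j.
    exists j0; first by split; rewrite // ffunE mulrC subrr.
    move=> k ck; rewrite /e /d !ffunE ck expr0n gtn_eqF; last by lia.
    by rewrite scaler0 mul0r !mulr0 subrr.
  have jj0 j : c j != 0 -> j = j0 %[mod m].
    move=> cj; have wn k : (w0 ^+ 2) ^+ k != 0 by rewrite !expf_neq0.
    apply: (hasse_val c0n cj (wn j0) (wn j)); rewrite ?(ltnW (ltn_ord _)) //.
    by apply/eqP; rewrite -subr_eq0; apply/eqP; have := eall j; rewrite /e /d !ffunE.
  have [ij|ij] := eqVneq (i %% m)%N (j0 %% m)%N.
    rewrite -[RHS]c0 /evp /evpi [RHS](bigID (fun j : 'I_J => j == i %[mod m])) /=.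
    rewrite [X in _ = _ + X]big1 ?addr0 // => j ji.
    have /eqP -> : c j == 0; last by rewrite rmorph0 mul0r.
    by apply: contraR ji => /jj0 /eqP; rewrite ij.
  apply: big1 => j /eqP ji.
  have /eqP -> : c j == 0; last by rewrite rmorph0 mul0r.
  by apply: contraR ij => /jj0; rewrite ji => ->.
(* The support is not minimal: e misses k, and the combination g of c and e misses j1, so induction
   applies to both. By linearity the component of c follows after cancelling e(j1). *)
case=> e [e0 [j1 ej1] [k [kc ek] ce]].
have ei : evpi i e = 0.
  apply: IH e0 _; rewrite -ltnS; apply: leq_trans cn; exact: psupp_proper kc ek ce.
pose g := [ffun j : 'I_J => e j1 * c j - c j1 * e j].
have gi : evpi i g = 0.
  apply: IH.
    rewrite -ltnS; apply: leq_trans cn; apply: (@psupp_proper _ _ j1).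
    - by rewrite inE; apply: contraNneq ej1 => /ce ->.
    - by rewrite ffunE mulrC subrr.
    by move=> j cj; rewrite ffunE cj (ce _ cj) !mulr0 subrr.
  transitivity (pev x (e j1) * evp c - pev x (c j1) * evp e); last by rewrite c0 e0 !mulr0 subrr.
  rewrite /evp !mulr_sumr -sumrB; apply: eq_bigr => j _.
  by rewrite ffunE rmorphB !rmorphM /=; ring.
have E : evpi i g = pev x (e j1) * evpi i c - pev x (c j1) * evpi i e.
  rewrite /evpi !mulr_sumr -sumrB; apply: eq_bigr => j _.
  by rewrite ffunE rmorphB !rmorphM /=; ring.
move: E; rewrite gi ei mulr0 subr0 => /esym/eqP; rewrite mulf_eq0 => /orP[/eqP/(pev_eq0 x1_neq0)/eqP|/eqP //].
by rewrite (negPf ej1).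
Qed.

End Grading.

(** * Iterated derivatives of the crank series *)

Section Filtration.
Variables (F : fieldType) (l m : nat).
Hypothesis charF : l \in [pchar F].
Hypothesis lE : l = m.*2.+1.
Hypothesis l_ge5 : (5 <= l)%N.
Local Notation A := (hasse F m).
Local Notation S := (series F).
Local Notation D := (@qder F).
Local Notation nu := (nu F).

(* For the derivation A^2 nu d/dx, the series f behaves like
   A^(1/2) x^(1/3) (1-x)^(-1/24); sigma is nu times the logarithmic derivative of
   x^(1/3) (1-x)^(-1/24). *)
Definition sigma : {poly F} := 24^-1 *: (7%:R *: 'X - 8%:R%:P).

(** The polynomials N_j with T^j f = f p^j N_j(x), where p = al / A(x). In j + 1/2, the j comes from
    D(p^j) and the 1/2 from T f. *)
Fixpoint npoly j : {poly F} :=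
  if j is i.+1 then
    (i%:R + 2^-1) *: (nu * A^`() * npoly i) + A * (sigma * npoly i + nu * (npoly i)^`())
  else 1.

Lemma npolyS j : npoly j.+1 =
  (j%:R + 2^-1) *: (nu * A^`() * npoly j) + A * (sigma * npoly j + nu * (npoly j)^`()).
Proof. by []. Qed.

(** Differentiating A^k adds k to j + 1/2. As A is coprime to nu A', divisibility of M by A cannot
    arise in this step from an M coprime to A unless j + k + 1/2 vanishes. *)
Lemma npoly_step j k M : npoly j = A ^+ k * M ->
  npoly j.+1 = A ^+ k * (((j + k)%:R + 2^-1) *: (nu * A^`() * M) + A * (sigma * M + nu * M^`())).
Proof.
move=> E; rewrite npolyS E derivM deriv_exp natrD -!mul_polyC !polyCD !polyC_natr.
by case: k {E} => [|k] /=; rewrite ?exprS; ring.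
Qed.

Lemma size_npoly j : (size (npoly j) <= j * m.+1 + 1)%N.
Proof.
elim: j => [|j IH]; first by rewrite size_poly1.
have snu : (size nu <= 3)%N.
  by rewrite (leq_trans (size_polyD _ _)) // size_polyN size_polyXn size_polyX.
have ssg : (size sigma <= 2)%N.
  rewrite (leq_trans (size_scale_leq _ _)) // (leq_trans (size_polyD _ _)) // size_polyN geq_max.
  by rewrite (leq_trans (size_scale_leq _ _)) ?size_polyX // (leq_trans (size_polyC_leq1 _)).
have sA : (size A <= m.+1)%N by rewrite size_hasse.
have sd (P : {poly F}) n : (size P <= n.+1)%N -> (size P^`() <= n)%N.
  by move=> Pn; apply: leq_trans (size_poly _ _) _; rewrite -subn1 leq_subLR.
have sM (P Q : {poly F}) n k : (size P <= n.+1)%N -> (size Q <= k.+1)%N -> (size (P * Q)%R <= (n + k).+1)%N.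
  move=> Pn Qk; apply: leq_trans (size_polyMleq _ _) _; lia.
have sM0 (P Q : {poly F}) n k : (size P <= n.+2)%N -> (size Q <= k)%N -> (size (P * Q)%R <= (n + k).+1)%N.
  move=> Pn Qk; apply: leq_trans (size_polyMleq _ _) _; lia.
have m0 : (0 < m)%N by lia.
rewrite npolyS; move: IH; set s := (j * m.+1)%N; rewrite addn1 => IH.
have -> : (j.+1 * m.+1 + 1 = (s + m.+1).+1)%N by rewrite mulSn addn1 addnC.
rewrite (leq_trans (size_polyD _ _)) // geq_max; apply/andP; split.
  apply: leq_trans (size_scale_leq _ _) _; rewrite addnC; apply: (sM _ _ m.+1 s) => //.
  have := sM0 nu A^`() 1%N m snu (sd _ _ sA); lia.
have -> : (s + m.+1 = m + s.+1)%N by lia.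
apply: (sM A _ m s.+1) => //; rewrite (leq_trans (size_polyD _ _)) // geq_max; apply/andP; split.
  exact: (sM _ _ 1%N s).
exact: (sM0 _ _ 1%N s snu (sd _ _ IH)).
Qed.

Lemma half_m : m%:R + 2^-1 = 0 :> F.
Proof.
apply: (mulfI (pchar_neq2 charF lE l_ge5)); rewrite mulr0 mulrDr mulfV ?(pchar_neq2 charF lE l_ge5) //.
exact: two_half charF lE.
Qed.

Hypothesis cop : coprimep A (nu * A^`()).
Hypothesis top : exists2 c, c != 0 & npoly m.*2 = c *: A ^+ m.+1.*2.

(* The factor j + k + 1/2 of npoly_step is nonzero for m < j < 2m and k <= m + 1,
   so without the divisibility the order at A could not reach its value at j = 2m. *)
Lemma npoly_dvd_aux v M : (v <= m.+1)%N -> npoly m.+1 = A ^+ v * M -> A %| M.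
Proof.
move=> vm E; have m2 : (2 <= m)%N by lia.
have chain i : (i <= m.-1)%N ->
    exists2 M', npoly (m.+1 + i) = A ^+ v * M' & (A %| M' -> A %| M).
  elim: i => [|i IH] im; first by exists M; rewrite // addn0.
  have [|M' E' dM] := IH; first by lia.
  exists (((m.+1 + i + v)%:R + 2^-1) *: (nu * A^`() * M') + A * (sigma * M' + nu * M'^`())).
    by rewrite addnS; apply: npoly_step.
  rewrite dvdp_addl ?dvdp_mulr // dvdpZr.
    by rewrite Gauss_dvdpr // dM.
  have -> : (m.+1 + i + v)%:R + 2^-1 = (i + v).+1%:R :> F.
    have -> : (m.+1 + i + v = m + (i + v).+1)%N by lia.
    by rewrite natrD addrAC half_m add0r.
  by apply: natF_neq0 charF _ _; lia.
have [M' E' dM] := chain m.-1 (leqnn _); apply: dM.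
have [c c0 T] := top; move: E'; rewrite (_ : (m.+1 + m.-1 = m.*2)%N) ?T; last by lia.
have -> : (m.+1.*2 = v + (m.+1.*2 - v.+1).+1)%N by lia.
rewrite exprD scalerAr => /(mulfI (expf_neq0 v (hasse_neq0 F m))) <-.
by rewrite dvdpZr // exprS dvdp_mulr.
Qed.

Lemma npoly_dvd : exists T, npoly m.+1 = A ^+ m.+2 * T.
Proof.
suff H v : (v <= m.+2)%N -> exists T, npoly m.+1 = A ^+ v * T by exact: H.
elim: v => [|v IH] vm; first by exists (npoly m.+1); rewrite mul1r.
have [M E] := IH (ltnW vm).
have /dvdpP[T MT] := npoly_dvd_aux vm E.
by exists T; rewrite E MT exprS; ring.
Qed.

(** The degree of [npoly m.+1] is at most (m+1)^2 = m(m+2) + 1, one more than that of A^(m+2); so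
    the cofactor has degree at most 1. *)
Lemma npoly_linear : exists t0 t1, npoly m.+1 = A ^+ m.+2 * (t0%:P + t1 *: 'X).
Proof.
have [T E] := npoly_dvd; exists T`_0, T`_1.
have sT : (size T <= 2)%N.
  have [->|T0] := eqVneq T 0; first by rewrite size_poly0.
  have := size_npoly m.+1; rewrite E size_mul ?expf_neq0 ?hasse_neq0 //.
  have := size_exp A m.+2; rewrite size_hasse /=.
  have := T0; rewrite -size_poly_gt0; have := expf_neq0 m.+2 (hasse_neq0 F m).
  rewrite -size_poly_gt0; move: (size T) (size (A ^+ m.+2)) => sT sA; nia.
rewrite E; congr (_ * _); rewrite {1}(_ : T = \poly_(i < 2) T`_i).
  by rewrite poly_def 2!big_ord_recr big_ord0 /= add0r expr0 expr1 alg_polyC.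
by apply/polyP => i; rewrite coef_poly; case: ltnP => // ii; rewrite nth_default // (leq_trans sT).
Qed.

End Filtration.

(** * Congruence classes of coefficients of f *)

Section Congruences.
Variables (F : fieldType) (l m : nat).
Hypothesis charF : l \in [pchar F].
Hypothesis lE : l = m.*2.+1.
Hypothesis l_ge5 : (5 <= l)%N.
Variables (K : closedFieldType) (iota : {rmorphism F -> K}).
Local Notation A := (hasse F m).
Local Notation S := (series F).
Local Notation D := (@qder F).
Local Notation nu := (nu F).
Local Notation a := (@aser F).
Local Notation b := (@bser F).
Local Notation al := (a ^+ 2).
Local Notation be := (b ^+ 2).
Local Notation x := (be / al).

Variables (f : S) (d : nat).
Hypothesis fv : f * vser F = tser F.
Hypothesis dE : 24%:R * d%:R = -1 :> F.

Let F2 := pchar_neq2 charF lE l_ge5.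
Let F3 := pchar_neq3 charF lE l_ge5.
Let w0 := A.[1].
Let w0n : w0 != 0 := hasse1_neq0 charF lE l_ge5.

(* The exponent n + d is n - 1/24 modulo l. *)
Definition tder (u : S) : S := Series (fun n => (n + d)%:R * u n).

Lemma tderE u : tder u = D u + sconst d%:R * u.
Proof. by apply: seriesP => n; rewrite scoefD scoefZ /= natrD mulrDl. Qed.

Lemma tder_iter j u n : iter j tder u n = (n + d)%:R ^+ j * u n.
Proof. by elim: j => [|j IH]; rewrite ?mul1r //= IH mulrA -exprS. Qed.

(** This is al / A(x), since al^m A(x) = w0. *)
Definition pser : S := sconst w0^-1 * al ^+ m.+1.
Local Notation p := pser.

Lemma aser0 : a 0%N = 1. Proof. by have [] := a_coefs F. Qed.
Lemma aser1 : a 1%N = 4. Proof. by have [] := a_coefs F. Qed.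
Lemma bser0 : b 0%N = 1. Proof. by have [] := b_coefs F. Qed.
Lemma bser1 : b 1%N = - 4. Proof. by have [] := b_coefs F. Qed.
Lemma aser_mul_bser : a * b = sq b ^+ 2. Proof. exact: ab_sq. Qed.
Lemma sq_aser : sq a *+ 2 = a + b. Proof. by rewrite a_add_b. Qed.

Lemma alS_unit : al \is a GRing.unit.
Proof. exact: al_unit aser0. Qed.
Lemma al_neq0 : al != 0. Proof. by apply: contraTneq alS_unit => ->; rewrite unitr0. Qed.

Lemma hasse_al : al ^+ m * pev x A = sconst w0.
Proof. have H := W_const charF lE l_ge5 aser_mul_bser sq_aser aser0 bser0 aser1 bser1. exact: H. Qed.

Lemma pser_hasse : p * pev x A = al.
Proof.
rewrite /p -mulrA exprS -mulrA hasse_al mulrCA -rmorphM /= mulVf //.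
by rewrite rmorph1 mulr1.
Qed.

Lemma pserX_hasse : p ^+ m * pev x A ^+ m.+1 = sconst w0.
Proof. by rewrite exprSr mulrA -exprMn pser_hasse hasse_al. Qed.

Lemma hasse_neq0S : pev x A != 0.
Proof.
by apply: contra_neq al_neq0 => H; rewrite -pser_hasse H mulr0.
Qed.

Lemma x_coef1_neq0 : x 1%N != 0.
Proof. have H := x1_neq0 charF lE l_ge5 aser0 bser0 aser1 bser1; exact: H. Qed.

Lemma qder_xS : D x = pev x nu * (p * pev x A).
Proof.
have H := qder_x charF lE l_ge5 aser_mul_bser sq_aser aser0 bser0 aser1 bser1.
by rewrite pser_hasse; exact: H.
Qed.

(** Differentiate al^m A(x) = w0 and use 2m = -1. *)
Lemma qder_al : D al = 2 * pev x (nu * A^`()) * al * p.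
Proof.
have H := congr1 D hasse_al; rewrite qder_const qderM qder_pev qder_xS pser_hasse in H.
apply: (mulIf hasse_neq0S).
transitivity (2 * pev x (nu * A^`()) * al * al); last by rewrite -{2}pser_hasse; ring.
have {H} : al ^+ m * (m%:R * D al * pev x A + pev x (nu * A^`()) * al ^+ 2) = 0.
  rewrite qderX in H; rewrite -[RHS](mulr0 al) -H rmorphM /=.
  have -> : al ^+ m = al ^+ m.-1 * al by rewrite -exprSr prednK //; lia.
  by ring.
move/eqP; rewrite mulf_eq0 (negPf (expf_neq0 _ al_neq0)) => /eqP H.
have m2 : 2 * m%:R = - 1 :> S.
  apply/eqP; rewrite -subr_eq0 opprK -natrM natr1 mul2n -lE.
  by rewrite (pcharf0 (pcharS charF)).
apply/eqP; rewrite -subr_eq0; apply/eqP.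
transitivity (- 2 * (m%:R * D al * pev x A + pev x (nu * A^`()) * al ^+ 2)
   + (2 * m%:R + 1) * D al * pev x A); first by ring.
by rewrite H m2 addNr; ring.
Qed.

Lemma qder_p : D p = p ^+ 2 * pev x (nu * A^`()).
Proof.
have m1 : m.+1%:R * 2 = 1 :> S.
  rewrite -natrM (_ : (m.+1 * 2 = l.+1)%N); last by lia.
  by rewrite -natr1 (pcharf0 (pcharS charF)) add0r.
rewrite {1}/p qderM qder_const mul0r add0r qderX /= qder_al.
transitivity ((m.+1%:R * 2) * (sconst w0^-1 * (al * al ^+ m)) * pev x (nu * A^`()) * p); first by ring.
by rewrite m1 -exprS -/p; ring.
Qed.

Lemma pchar_neq24 : 24%:R != 0 :> F.
Proof. by rewrite (_ : 24 = 2 * 2 * 2 * 3)%N // !natrM !mulf_neq0. Qed.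

Lemma npoly1 : npoly F m 1 = 2^-1 *: (nu * A^`()) + A * sigma F.
Proof.
rewrite npolyS mulr0n add0r [npoly F m 0]/(1%:P) derivC mulr0 addr0.
by rewrite !mulr1.
Qed.

(** As 24 d = -1, the shift cancels the isolated term al of [qder_f]; what remains is divisible by
    al and involves only p and x. *)
Lemma tder_f : tder f = f * p * pev x (npoly F m 1).
Proof.
have tv : tser F * vser F ^+ 2 = sq (tser F) * sq (vser F).
  by rewrite expr2 mulrA gauss // e_mul_v -gauss // rmorphM.
have H := qder_f F2 F3 aser_mul_bser sq_aser aser0 bser0 aser1 bser1 (erefl a) (erefl b) (t_mul_neg F2) tv (@v0E F) fv.
have c24 : sconst 24%:R != 0 :> S.
  by apply/eqP => /(congr1 (fun s => scoef s 0)) /eqP; rewrite /= (negPf pchar_neq24).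
apply: (mulfI c24); apply: (mulfI al_neq0).
have d24 : sconst 24%:R * sconst d%:R = - 1 :> S by rewrite -rmorphM /= dE rmorphN rmorph1.
rewrite tderE.
transitivity (24 * al * D f + (sconst 24%:R * sconst d%:R) * al * f).
  by rewrite rmorph_nat; ring.
rewrite d24 H qder_al npoly1.
transitivity (al * f * (sconst 24%:R * (p * pev x (2^-1 *: (nu * A^`()) + A * sigma F)))); last by ring.
have h2 : sconst 24%:R * sconst 2^-1 = 12 :> S.
  by rewrite -rmorphM /= (_ : 24 = 12 * 2)%N // natrM mulfK // rmorph_nat.
have h24 : sconst 24%:R * sconst 24^-1 = 1 :> S.
  by rewrite -rmorphM /= mulfV ?pchar_neq24 // rmorph1.
have -> : sconst 24%:R * (p * pev x (2^-1 *: (nu * A^`()) + A * sigma F)) =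
  12 * p * pev x (nu * A^`()) + (p * pev x A) * (7 * x - 8).
  rewrite [pev x (_ + _)]rmorphD /= pevZ [pev x (A * _)]rmorphM /= /sigma pevZ [pev x (_ - _)]rmorphB /= pevZ pevX pevC !rmorph_nat.
  transitivity ((sconst 24%:R * sconst 2^-1) * p * pev x (nu * A^`())
     + (sconst 24%:R * sconst 24^-1) * (p * pev x A) * (7 * x - 8)); first by ring.
  by rewrite h2 h24 mul1r.
rewrite pser_hasse.
have xal : x * al = be by rewrite divrK // alS_unit.
transitivity (al * f * (12 * p * pev x (nu * A^`()) - 8 * al + 7 * (x * al))); last by ring.
by rewrite xal; ring.
Qed.

Lemma tderM u v : tder (u * v) = tder u * v + u * D v.
Proof. by rewrite !tderE qderM; ring. Qed.

Lemma tder_iter_f j : iter j tder f = f * p ^+ j * pev x (npoly F m j).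
Proof.
elim: j => [|j IH]; first by rewrite rmorph1 !mulr1.
have e1 : pev x (npoly F m 1) = sconst 2^-1 * pev x (nu * A^`()) + pev x A * pev x (sigma F).
  by rewrite npoly1 [pev x (_ + _)]rmorphD /= [pev x (A * _)]rmorphM /= pevZ.
have e2 N : pev x ((j%:R + 2^-1) *: (nu * A^`() * N) + A * (sigma F * N + nu * N^`())) =
    (j%:R + sconst 2^-1) * (pev x (nu * A^`()) * pev x N) +
    pev x A * (pev x (sigma F) * pev x N + pev x nu * pev x N^`()).
  rewrite [pev x (_ + A * _)]rmorphD /= [pev x (A * _)]rmorphM /= [pev x (_ + nu * _)]rmorphD /= pevZ.
  rewrite [pev x (nu * A^`() * _)]rmorphM /= [pev x (sigma F * _)]rmorphM /= [pev x (nu * N^`())]rmorphM /=.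
  by rewrite [sconst (_ + _)]rmorphD rmorph_nat.
rewrite iterS IH -mulrA tderM tder_f e1 qderM qderX qder_p qder_pev qder_xS npolyS e2.
move: (npoly F m j) (pev x (nu * _)) (sconst _) => N U h.
by case: j {IH e2} => [|j] /=; rewrite ?exprS; ring.
Qed.

Lemma natF_frob n : n%:R ^+ l = n%:R :> F.
Proof. by rewrite -(pFrobenius_autE charF) pFrobenius_aut_nat. Qed.

Lemma f0E : f 0%N = 1.
Proof.
have := congr1 (fun s => scoef s 0) fv; rewrite scoefM0 v0E mulr1 => ->.
by have [] := t_coefs F.
Qed.

Lemma f_neq0 : f != 0.
Proof. by apply/eqP => H; move/eqP: f0E; rewrite H eq_sym oner_eq0. Qed.

(** Minus the projector onto the exponents n with n + d = rho. The sum of rho^(l-1-j) z^j over 0 <=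
    j < l is (rho^l - z^l)/(rho - z) = 1 for z other than rho, and its term j = 0 is rho^(l-1) = 1;
    leaving that term out gives 0. *)
Definition class_coef (rho : F) : {ffun 'I_l -> {poly F}} :=
  [ffun j : 'I_l => if j == 0 :> nat then 0 else rho ^+ (l.-1 - j) *: npoly F m j].

Lemma class_coefE (rho : F) (P : pred nat) n :
  (f * \sum_(j < l | P j) pev x (class_coef rho j) * p ^+ j) n =
  (\sum_(j < l | P j) (if j == 0 :> nat then 0 else rho ^+ (l.-1 - j) * (n + d)%:R ^+ j)) * f n.
Proof.
rewrite mulr_sumr scoef_sum mulr_suml; apply: eq_bigr => j _; rewrite ffunE.
case: ifP => _; first by rewrite rmorph0 mul0r mulr0 mul0r scoef0.
transitivity ((sconst (rho ^+ (l.-1 - j)) * iter j tder f) n).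
  by rewrite tder_iter_f pevZ; congr (scoef _ n); ring.
by rewrite scoefZ tder_iter mulrA.
Qed.

Lemma class_transfer r n : r%:R != 0 :> F ->
  (forall k, (k + d)%:R = r%:R :> F -> f k = 0) ->
  (n + d)%:R ^+ m = r%:R ^+ m :> F -> f n = 0.
Proof.
set rho : F := r%:R => rho0 Hr; set y : F := _%:R => ym.
have evc : evp x p (class_coef rho) = 0.
  apply: (mulfI f_neq0); rewrite mulr0; apply: seriesP => k.
  rewrite (class_coefE rho predT); set z : F := (k + d)%:R; rewrite scoef0.
  have [zr|zr] := eqVneq z rho; first by rewrite Hr // mulr0.
  suff -> : \sum_(j < l) (if j == 0 :> nat then 0 else rho ^+ (l.-1 - j) * z ^+ j) = 0.
    by rewrite mul0r.
  have rz : rho - z != 0 by rewrite subr_eq0 eq_sym.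
  have H : \sum_(j < l) rho ^+ (l.-1 - j) * z ^+ j = 1.
    by apply: (mulfI rz); rewrite -subrXX !natF_frob mulr1.
  have l0 : (0 < l)%N by lia.
  have rl : rho ^+ l.-1 = 1.
    by apply: (mulfI rho0); rewrite mulr1 -exprS prednK // natF_frob.
  move: H; rewrite (bigD1 (Ordinal l0)) //= subn0 mulr1 rl => /eqP.
  rewrite -subr_eq0 addrAC subrr add0r => /eqP H.
  rewrite (bigD1 (Ordinal l0)) //= add0r -[RHS]H; apply: eq_bigr => j /eqP/val_eqP /= j0.
  by rewrite (negPf j0).
have J2 : (m.+1 < l)%N by lia.
have J1 : (1 < l)%N by lia.
have E : evpi m x p 1 (class_coef rho) = 0.
  have H := evp_grading charF lE l_ge5 iota x_coef1_neq0 w0n pserX_hasse (leqnn _) evc 1%N.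
  exact: H.
have := class_coefE rho (fun j => j == 1 %[mod m]) n.
rewrite -[\sum_(j < l | _) pev _ _ * _]/(evpi m x p 1 (class_coef rho)) E mulr0 scoef0.
(* Below l = 2m + 1, only the exponents 1 and m + 1 are 1 modulo m. With y^m = rho^m their two
   contributions coincide, so that 2 rho^(2m-1) y f(n) = 0. *)
rewrite (bigD1 (Ordinal J1)) //= (bigD1 (Ordinal J2)) /=; last first.
  apply/andP; split; last by rewrite -val_eqE /=; lia.
  by rewrite -[m.+1]addn1 modnDl.
rewrite big1 ?addr0 => [|j /andP[/andP[jm /eqP/val_eqP /= j1] /eqP/val_eqP /= jm1]]; last first.
  case: eqP => // j0; exfalso; move: jm; rewrite eqn_mod_dvd; last by lia.
  case/dvdnP => k Hk; have jl : (j < m.*2.+1)%N by rewrite -lE.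
  have : (k < 2)%N by nia.
  case: k Hk => [|[|//]]; lia.
have -> : (l.-1 - m.+1 = m.-1)%N by lia.
have -> : (l.-1 - 1 = m.-1 + m)%N by lia.
rewrite exprD (exprS _ m) -/y ym expr1.
move=> /esym/eqP; rewrite mulf_eq0 => /orP[|/eqP //].
have -> : rho ^+ m.-1 * rho ^+ m * y + rho ^+ m.-1 * (y * rho ^+ m) = 2%:R * (rho ^+ m.-1 * rho ^+ m * y).
  by ring.
rewrite !mulf_eq0 (negPf F2) !(negPf (expf_neq0 _ rho0)) /= => /eqP y0.
have m0 : (0 < m)%N by lia.
by move/eqP: ym; rewrite y0 expr0n gtn_eqF // eq_sym (negPf (expf_neq0 _ rho0)).
Qed.

Lemma v_coefs : [/\ vser F 1%N = 1, vser F 2%N = 1 & vser F 3%N = 2].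
Proof.
have E n k : (k <= n)%N -> vser F k = (\prod_(i < n.+1) (1 + qvar ^+ i.+1) : S) k.
  move=> kn; rewrite -[LHS]/((\prod_(i < k.+1) (1 + qvar ^+ i.+1) : S) k).
  elim: n kn => [|n IH]; first by rewrite leqn0 => /eqP ->.
  rewrite leq_eqVlt => /orP[/eqP -> //|kn].
  have -> : \prod_(i < n.+2) (1 + qvar ^+ i.+1) =
      \prod_(i < n.+1) (1 + qvar ^+ i.+1) * (1 + qvar ^+ n.+2) :> S by rewrite big_ord_recr.
  rewrite IH // mulrDr mulr1 scoefD mulrC scoef_qXM leqNgt.
  by rewrite ltnW ?addr0.
have E4 : \prod_(i < 4) (1 + qvar ^+ i.+1) =
    1 + qvar + qvar ^+ 2 + 2%:R * qvar ^+ 3 + qvar ^+ 4 * (2%:R + 2%:R * qvar + 2%:R * qvar ^+ 2 + 2%:R * qvar ^+ 3 + qvar ^+ 4 * (1 + qvar + qvar ^+ 2)) :> S.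
  by rewrite !big_ord_recl big_ord0 /= /bump /=; ring.
split; rewrite (E 3%N) // E4 !scoefD scoef_qXM scoef_natM !scoef_qX scoef1 /=; ring.
Qed.

Lemma f_coefs : [/\ f 1%N = - 3%:R, f 2%N = 2%:R & f 3%N = - 1].
Proof.
have [v1 v2 v3] := v_coefs; have [_ t1 t2 t3] := t_coefs F; have f0 := f0E.
have f1 : f 1%N = - 3%:R.
  have := congr1 (fun s => scoef s 1%N) fv; rewrite scoefM1 v0E f0 v1 t1 => H.
  by transitivity ((1 * 1 + f 1%N * 1) - 1); [ring | rewrite H; ring].
have f2 : f 2%N = 2%:R.
  have := congr1 (fun s => scoef s 2%N) fv; rewrite scoefM2 v0E f0 v1 v2 t2 f1 => H.
  by transitivity ((1 * 1 + - 3%:R * 1 + f 2%N * 1) + 2%:R); [ring | rewrite H; ring].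
split=> //.
have := congr1 (fun s => scoef s 3%N) fv; rewrite scoefM3 v0E f0 v1 v2 v3 t3 f1 f2 => H.
by transitivity ((1 * 2 + - 3%:R * 1 + 2%:R * 1 + f 3%N * 1) - 1); [ring | rewrite H; ring].
Qed.

(** Under the hypothesis T^(l-1) f = f, so p^(2m) N_(2m)(x) = 1; compare with p^(2m) A^(2m+2) =
    w0^2. *)
Lemma npoly_top : (forall n, (n + d)%:R = 0 :> F -> f n = 0) ->
  exists2 c, c != 0 & npoly F m m.*2 = c *: A ^+ m.+1.*2.
Proof.
move=> H0; exists (w0 ^+ 2)^-1; first by rewrite invr_eq0 expf_neq0.
have H1 : p ^+ m.*2 * pev x (npoly F m m.*2) = 1.
  apply: (mulfI f_neq0); rewrite mulrA -tder_iter_f mulr1; apply: seriesP => n.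
  rewrite tder_iter; have [yn|yn] := eqVneq ((n + d)%:R : F) 0; first by rewrite H0 // mulr0.
  have -> : (n + d)%:R ^+ m.*2 = 1 :> F.
    by apply: (mulfI yn); rewrite mulr1 -exprS -lE natF_frob.
  by rewrite mul1r.
have H2 : p ^+ m.*2 * pev x A ^+ m.+1.*2 = sconst (w0 ^+ 2).
  by rewrite rmorphXn /= -pserX_hasse -!mul2n !(mulnC 2) !exprM; ring.
have p0 : p ^+ m.*2 != 0.
  by apply: contra_eq_neq H1 => ->; rewrite mul0r eq_sym oner_eq0.
apply: (pev_inj x_coef1_neq0); apply: (mulfI p0); rewrite H1 pevZ [pev x (A ^+ _)]rmorphXn /=.
by rewrite mulrCA H2 -rmorphM /= mulVf ?expf_neq0 // rmorph1.
Qed.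

Lemma intF_eq0 z : (z%:~R == 0 :> F) = (l %| `|z|)%N.
Proof.
case: z => n; first exact: natF_eq0 charF _.
by rewrite NegzE rmorphN /= oppr_eq0; exact: natF_eq0 charF _.
Qed.

(** Euler's criterion, lifted to integers so that the equations of [coef_eqs] become divisibilities
    by l. The value 0 occurs only if l divides 24(n + d) = 24n - 1. *)
Lemma sign_power n : exists2 z : int, (n + d)%:R ^+ m = z%:~R :> F &
  [\/ z = 1, z = -1 | z = 0 /\ (l %| absz (24%:Z * n%:Z - 1)%R)%N].
Proof.
have m0 : (0 < m)%N by lia.
have [yn|yn] := eqVneq ((n + d)%:R : F) 0.
  exists 0; first by rewrite yn expr0n gtn_eqF.
  constructor 3; split=> //; rewrite -intF_eq0 rmorphB rmorphM rmorph1 /=.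
  have : 24%:R * (n + d)%:R = 0 :> F by rewrite yn mulr0.
  by rewrite natrD mulrDr dE => /eqP.
have : ((n + d)%:R ^+ m) ^+ 2 = 1 :> F.
  by rewrite -exprM muln2; apply: (mulfI yn); rewrite mulr1 -exprS -lE natF_frob.
move/eqP; rewrite -subr_eq0 subr_sqr_1 mulf_eq0 subr_eq0 addr_eq0 => /orP[] /eqP ->.
  by exists 1 => //; constructor 1.
by exists (-1) => //; constructor 2.
Qed.

(* The coefficients of q^0, ..., q^3 in tder^(m+1) f = f (u0 al + u1 be), with
   u0 and u1 eliminated. *)
Lemma coef_eqs : (forall n, (n + d)%:R = 0 :> F -> f n = 0) ->
  let e n := (n + d)%:R ^+ m : F in
  207%:R * e 1%N - 17%:R * e 0%N - 94%:R * e 2%N = 0 /\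
  55%:R * e 0%N - 414%:R * e 1%N + 71%:R * e 3%N = 0.
Proof.
move=> H0 e.
have cop := hasse_coprime charF lE l_ge5 iota.
have [t0 [t1 T]] := npoly_linear charF lE l_ge5 cop (npoly_top H0).
pose u0 := w0 * t0; pose u1 := w0 * t1.
pose G := sconst u0 * al + sconst u1 * be.
have E : iter m.+1 tder f = f * G.
  rewrite tder_iter_f T rmorphM /= [pev x (A ^+ _)]rmorphXn /= [pev x (_ + _)]rmorphD /= pevC pevZ pevX.
  transitivity (f * ((p ^+ m * pev x A ^+ m.+1) * ((p * pev x A) * sconst t0 + sconst t1 * ((p * pev x A) * x)))).
    by rewrite !exprS; ring.
  rewrite pserX_hasse pser_hasse [al * x]mulrC divrK ?alS_unit // /G /u0 /u1 !rmorphM /=.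
  ring.
have [al0 al1 al2 al3] := al_coefs F; have [be0 be1 be2 be3] := be_coefs F.
have f0 := f0E; have [f1 f2 f3] := f_coefs.
have yE n : 24%:R * (n + d)%:R = 24%:R * n%:R - 1 :> F by rewrite natrD mulrDr dE.
have Ec n : 24%:R * (f * G) n = (24%:R * n%:R - 1) * e n * f n.
  by rewrite -E tder_iter exprS -yE /e; ring.
have G0 : G 0%N = u0 + u1 by rewrite scoefD !scoefZ al0 be0 !mulr1.
have G1 : G 1%N = 8%:R * (u0 - u1) by rewrite scoefD !scoefZ al1 be1; ring.
have G2 : G 2%N = 24%:R * (u0 + u1) by rewrite scoefD !scoefZ al2 be2; ring.
have G3 : G 3%N = 32%:R * (u0 - u1) by rewrite scoefD !scoefZ al3 be3; ring.
have c0 := Ec 0%N; have c1 := Ec 1%N; have c2 := Ec 2%N; have c3 := Ec 3%N.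
rewrite scoefM0 f0 G0 in c0; rewrite scoefM1 f0 f1 G0 G1 in c1.
rewrite scoefM2 f0 f1 f2 G0 G1 G2 in c2; rewrite scoefM3 f0 f1 f2 f3 G0 G1 G2 G3 in c3.
move: (e 0%N) (e 1%N) (e 2%N) (e 3%N) c0 c1 c2 c3 => e0 e1 e2 e3.
move: (u0 + u1) (u0 - u1) => s r c0 c1 c2 c3.
have comb (c c' x0 y0 x1 y1 x2 y2 g : F) : x0 = y0 -> x1 = y1 -> x2 = y2 ->
    g = (x0 - y0) + c * (x1 - y1) + c' * (x2 - y2) -> g = 0.
  by move=> -> -> -> ->; rewrite !subrr !mulr0 !addr0.
split; first by apply: (comb 3%:R (- 17%:R) _ _ _ _ _ _ _ c2 c1 c0); ring.
by apply: (comb (- 6%:R) 55%:R _ _ _ _ _ _ _ c3 c1 c0); ring.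
Qed.

Lemma no_congruence : (7 <= l)%N -> ~ (forall n, (n + d)%:R = 0 :> F -> f n = 0).
Proof.
move=> l7 /coef_eqs /=.
have [z0 -> H0] := sign_power 0; have [z1 -> H1] := sign_power 1.
have [z2 -> H2] := sign_power 2; have [z3 -> H3] := sign_power 3.
case=> E1 E2.
have {}E1 : (l %| absz (207 * z1 - 17 * z0 - 94 * z2)%R)%N.
  by rewrite -intF_eq0 !rmorphB !rmorphM /= E1.
have {}E2 : (l %| absz (55 * z0 - 414 * z1 + 71 * z3)%R)%N.
  by rewrite -intF_eq0 rmorphD rmorphB !rmorphM /= E2.
have lp := pchar_prime charF.
(* Each sign pattern below yields a positive multiple of l all of whose prime factors are below
   7. *)
have small k : (0 < k)%N -> all (fun r => r < 7)%N (primes k) -> (l %| k)%N -> False.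
  move=> k0 /allP pk lk; have : l \in primes k by rewrite mem_primes lp k0.
  by move/pk; lia.
have {}E : (l %| gcdn (absz (207 * z1 - 17 * z0 - 94 * z2)%R) (absz (55 * z0 - 414 * z1 + 71 * z3)%R))%N.
  by rewrite dvdn_gcd E1.
have gg k : (l %| k)%N -> (l %| gcdn (gcdn (absz (207 * z1 - 17 * z0 - 94 * z2)%R) (absz (55 * z0 - 414 * z1 + 71 * z3)%R)) k)%N.
  by move=> lk; rewrite dvdn_gcd E.
have n0 : (z0 = 0 /\ (l %| absz (24%:Z * 0%:Z - 1)%R)%N) -> False.
  by case=> _; apply: small.
(* A vanishing power at n = 1, 2, 3 means that l divides 23, 47, 71; in these cases the gcd with
   that number settles the pattern. At n = 0 it would mean that l divides 1. *)
case: H0 => [z0E|z0E|/n0 //]; case: H1 => [z1E|z1E|[z1E d1]];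
case: H2 => [z2E|z2E|[z2E d2]]; case: H3 => [z3E|z3E|[z3E d3]];
  subst z0 z1 z2 z3;
  first [ move: E; apply: small; by vm_compute
        | move: (gg _ d1); apply: small; by vm_compute
        | move: (gg _ d2); apply: small; by vm_compute
        | move: (gg _ d3); apply: small; by vm_compute ].
Qed.

End Congruences.

(** * The congruence modulo 5 *)

Section Five.
Variable F : fieldType.
Hypothesis charF : 5%N \in [pchar F].
Local Notation A := (hasse F 2).
Local Notation N := (npoly F 2).
Local Notation X := ('X : {poly F}).

Lemma five_eq0 : 5%:R = 0 :> {poly F}.
Proof. by rewrite -polyC_natr (pcharf0 charF). Qed.

Lemma eq_mod5 (P Q C : {poly F}) : P = Q + 5%:R * C -> P = Q.
Proof. by rewrite five_eq0 mul0r addr0. Qed.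

Lemma deriv_natM c (P : {poly F}) : (c%:R * P)^`() = c%:R * P^`().
Proof. by rewrite !mulr_natl derivMn. Qed.

Lemma deriv_one : 1^`() = 0 :> {poly F}. Proof. exact: derivC. Qed.
Lemma deriv_nat c : c%:R^`() = 0 :> {poly F}.
Proof. by rewrite derivMn deriv_one mul0rn. Qed.

Lemma hasse5 : A = 1 + 4%:R * X + X ^+ 2.
Proof.
rewrite /hasse poly_def 3!big_ord_recr big_ord0 /= add0r.
by rewrite /= bin0 bin1 binn -!mul_polyC !polyC_natr; ring.
Qed.

Lemma npoly5S j P : N j = P ->
  N j.+1 = (j + 3)%:R * ((X ^+ 2 - X) * (4%:R + 2%:R * X) * P) +
    (1 + 4%:R * X + X ^+ 2) * ((8%:R - 7%:R * X) * P + (X ^+ 2 - X) * P^`()).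
Proof.
move=> E; rewrite npolyS E hasse5 /nu.
have F2 : 2%:R != 0 :> F by rewrite -(dvdn_pcharf charF).
have h : 2^-1 = 3%:R :> F.
  apply: (mulfI F2); rewrite mulfV // -natrM.
  by rewrite (_ : 2 * 3 = 1 + 5)%N // natrD (pcharf0 charF) addr0.
have h24 : 24^-1 = -1 :> F.
  have F24 : 24%:R != 0 :> F by rewrite -(dvdn_pcharf charF).
  apply: (mulfI F24); rewrite mulfV // mulrN1; apply/eqP; rewrite -addr_eq0 -(natrD _ 1).
  by rewrite -(dvdn_pcharf charF).
have -> : sigma F = 8%:R - 7%:R * X.
  by rewrite /sigma h24 scaleN1r opprB polyC_natr -mul_polyC polyC_natr.
have -> : (1 + 4%:R * X + X ^+ 2)^`() = 4%:R + 2%:R * X.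
  by rewrite !derivD deriv_natM derivX derivXn (derivC 1) expr1; ring.
by rewrite h -natrD -mul_polyC polyC_natr.
Qed.

(* The witnesses for eq_mod5 are integral quotients by 5. *)
Lemma npoly5_top : N 4 = A ^+ 6.
Proof.
have N1 : N 1 = - 2%:R - 2%:R * X + X ^+ 2 - X ^+ 3.
  rewrite (@npoly5S 0 1) // (derivC 1) mulr0 addr0.
  by apply: (@eq_mod5 _ _ (2%:R + 3%:R * X - 3%:R * X ^+ 2)); ring.
have N2 : N 2 = - 1 - 2%:R * X - 2%:R * X ^+ 2 - X ^+ 3 + X ^+ 5 + X ^+ 6.
  rewrite (npoly5S N1) !(derivD, derivB, derivN, deriv_natM, derivX, derivXn, deriv_nat, deriv_one).
  by apply: (@eq_mod5 _ _ (- 3%:R - 6%:R * X + 4%:R * X ^+ 2 + 3%:R * X ^+ 3 - 2%:R * X ^+ 4 + X ^+ 5 - X ^+ 6)); ring.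
have N3 : N 3 = 2%:R + X - X ^+ 2 - 2%:R * X ^+ 3 - X ^+ 4 - X ^+ 5 + X ^+ 6 + 2%:R * X ^+ 7 + X ^+ 8 - X ^+ 9.
  rewrite (npoly5S N2) !(derivD, derivB, derivN, deriv_natM, derivX, derivXn, deriv_nat, deriv_one).
  by apply: (@eq_mod5 _ _ (- 2%:R - 4%:R * X - X ^+ 2 + 2%:R * X ^+ 3 + X ^+ 4 - X ^+ 5 - 3%:R * X ^+ 6 - 2%:R * X ^+ 7 + 3%:R * X ^+ 8 + 2%:R * X ^+ 9)); ring.
rewrite hasse5 (npoly5S N3) !(derivD, derivB, derivN, deriv_natM, derivX, derivXn, deriv_nat, deriv_one).
apply: (@eq_mod5 _ _ (3%:R + 2%:R * X - 5%:R * X ^+ 2 + 4%:R * X ^+ 4 - X ^+ 6 - 6%:R * X ^+ 7 - 8%:R * X ^+ 8 + 3%:R * X ^+ 9 + 13%:R * X ^+ 10 - X ^+ 11 - 3%:R * X ^+ 12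
  - (5%:R * X + 49%:R * X ^+ 2 + 280%:R * X ^+ 3 + 963%:R * X ^+ 4 + 2045%:R * X ^+ 5 + 2647%:R * X ^+ 6 + 2045%:R * X ^+ 7 + 963%:R * X ^+ 8 + 280%:R * X ^+ 9 + 49%:R * X ^+ 10 + 5%:R * X ^+ 11))).
by ring.
Qed.

Variables (K : closedFieldType) (iota : {rmorphism F -> K}) (f : series F) (d : nat).
Hypothesis fv : f * vser F = tser F.
Hypothesis dE : 24%:R * d%:R = -1 :> F.

(** For l = 5, m = 2 and A(1) = 6 = 1, so p^2 A^3 = 1 and N_4 = A^6 gives T^4 f = f. The coefficient
    of q^n on the left carries the factor (n + d)^4. *)
Lemma congruence5 n : (n + d)%:R = 0 :> F -> f n = 0.
Proof.
move=> yn; have l5 : 5%N = 2.*2.+1 by [].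
have P := pserX_hasse charF l5 (leqnn _).
have w1 : A.[1] = 1.
  by transitivity (1 + 5%:R : F); [rewrite horner_poly 3!big_ord_recr big_ord0 /= bin0 bin1 binn; ring | rewrite (pcharf0 charF) addr0].
rewrite w1 rmorph1 in P.
have : iter 4 (tder d) f = f.
  rewrite (tder_iter_f charF l5 (leqnn _) fv dE) npoly5_top [pev _ (A ^+ 6)]rmorphXn /=.
  rewrite -mulrA [X in f * X](_ : _ = 1) ?mulr1 //.
  transitivity ((pser F 2 ^+ 2 * pev (bser F ^+ 2 / aser F ^+ 2) A ^+ 3) ^+ 2); first by ring.
  by rewrite P expr1n.
move/(congr1 (fun s => scoef s n)); rewrite tder_iter yn expr0n /= mul0r => <- //.
Qed.

End Five.

(** * The generating function of the crank parity *)

Section QBinomial.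
Variable F : fieldType.
Local Notation S := (series F).
Local Notation q := (@qvar F).
Variable a : S.

Definition poch k : S := \prod_(i < k) (1 - a * q ^+ i).
Definition qterm i k : S := poch k * ((-1) ^+ k * q ^+ (i * k)) * (epart F k)^-1.
Definition qsum i : S := isum (qterm i).

Lemma pochS k : poch k.+1 = poch k * (1 - a * q ^+ k).
Proof. by rewrite /poch big_ord_recr. Qed.

Lemma qterm0 i : qterm i 0 = 1.
Proof. by rewrite /qterm /poch /epart !big_ord0 muln0 expr0 !mul1r invr1. Qed.

Lemma ordge_qterm i k : ordge (i * k) (qterm i k).
Proof.
rewrite /qterm (_ : _ * _ * _ = q ^+ (i * k) * (poch k * (-1) ^+ k * (epart F k)^-1)); last by ring.
exact/ordgeMl/ordge_qX.
Qed.

Lemma qlim_qsum i : (0 < i)%N -> qlim (fun n => \sum_(k < n) qterm i k) (qsum i).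
Proof.
move=> i0; apply: qlim_sum => k; apply: ordgeW (@ordge_qterm i k).
exact: leq_pmull.
Qed.

Lemma epartV k : (epart F k.+1)^-1 * (1 - q ^+ k.+1) = (epart F k)^-1.
Proof.
have u0 := epart_unit F k; have u1 := epart_unit F k.+1.
apply: (mulrI u0); rewrite mulrV //.
have -> : epart F k * ((epart F k.+1)^-1 * (1 - q ^+ k.+1)) =
  (epart F k * (1 - q ^+ k.+1)) * (epart F k.+1)^-1 by ring.
by rewrite -epartS mulrV.
Qed.

Lemma qterm_step i k : qterm i k.+1 - qterm i.+1 k.+1 = - q ^+ i * (qterm i k - a * qterm i.+1 k).
Proof.
rewrite /qterm -(epartV k) pochS (exprS (-1)) !mulnS !mulSn !exprD. rewrite (exprS q i) (exprS q k).
move: (q ^+ i) (q ^+ k) (q ^+ (i * k)) (poch k) ((-1) ^+ k) (_^-1) => x y z u w r; ring.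
Qed.

(** The functional equation [qsumS] in finite form. By [qterm_step], the terms of index k + 1 are
    balanced against those of index k, hence the two lengths K + 1 and K. *)
Lemma qsum_partial i K :
  \sum_(k < K.+1) qterm i k + q ^+ i * \sum_(k < K) qterm i k =
  \sum_(k < K.+1) qterm i.+1 k + a * q ^+ i * \sum_(k < K) qterm i.+1 k.
Proof.
elim: K => [|K IH].
  by rewrite !big_ord1 !big_ord0 !qterm0 !mulr0.
rewrite 2!(big_ord_recr K.+1) /= [in X in _ + _ * X]big_ord_recr [in X in _ = _ + _ * X]big_ord_recr /=.
have := qterm_step i K.
move: (qterm i K.+1) (qterm i.+1 K.+1) IH => u u'.
rewrite 2!big_ord_recr /=; move: (qterm i K) (qterm i.+1 K) => w w'.
move: (\sum_(k < K) _) (\sum_(k < K) _) => s' s IH /eqP; rewrite subr_eq => /eqP ->.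
transitivity ((s + w + q ^+ i * s) + (u' - q ^+ i * (w - a * w') + q ^+ i * w)); first by ring.
by rewrite IH; ring.
Qed.

Lemma qsumS i : (0 < i)%N -> (1 + q ^+ i) * qsum i = (1 + a * q ^+ i) * qsum i.+1.
Proof.
move=> i0; have L1 := qlim_qsum i0; have L2 := qlim_qsum (ltn0Sn i).
have H1 := qlimD (qlim_shift 1 L1) (qlimM (qlim_cst (q ^+ i)) L1).
have H2 := qlimD (qlim_shift 1 L2) (qlimM (qlim_cst (a * q ^+ i)) L2).
have E : qsum i + q ^+ i * qsum i = qsum i.+1 + a * q ^+ i * qsum i.+1.
  apply: (qlim_unique H1); apply: qlim_eq H2 => n; rewrite addn1; exact/esym/qsum_partial.
by rewrite !mulrDl !mul1r E.
Qed.

Lemma qsum_prod M : qsum 1 * vpart F M = (\prod_(i < M) (1 + a * q ^+ i.+1)) * qsum M.+1.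
Proof.
elim: M => [|M IH]; first by rewrite /vpart !big_ord0 mul1r mulr1.
rewrite vpartS mulrA IH big_ord_recr /= -mulrA [qsum _ * _]mulrC qsumS //.
by rewrite mulrA.
Qed.

Lemma qlim_qsum1 : qlim (fun M => qsum M.+1) 1.
Proof.
apply: qlim_near => n.
have [N /(_ (maxn N 1) (leq_maxl _ _))] := @qlim_qsum n.+1 (ltn0Sn n) n.
move=> H i i_n; rewrite scoefB -(H i (ltnW i_n)).
have -> : maxn N 1 = (maxn N 1).-1.+1 by rewrite prednK // leq_maxr.
rewrite big_ord_recl qterm0 scoefD addrAC subrr add0r scoef_sum big1 // => k _.
apply: (@ordge_qterm n.+1 (lift ord0 k)); apply: leq_trans i_n _.
by rewrite /= /bump /=; nia.
Qed.

Lemma qsum_v w : qlim (fun M => \prod_(i < M) (1 + a * q ^+ i.+1)) w -> qsum 1 * vser F = w.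
Proof.
move=> Hw; apply: (qlim_unique (qlimM (qlim_cst (qsum 1)) (qlim_v F))).
rewrite -[w]mulr1; apply: qlim_eq (qlimM Hw qlim_qsum1) => M.
by rewrite qsum_prod.
Qed.

End QBinomial.

Section Euler.
Variable F : fieldType.
Local Notation S := (series F).
Local Notation q := (@qvar F).

Lemma euler_v : qsum 0 1 * vser F = 1.
Proof.
apply: qsum_v; apply: qlim_eq (qlim_cst 1) => M.
by rewrite big1 // => i _; rewrite mul0r addr0.
Qed.

(** For a = -q the product is that of 1 - q^(i+2) over i >= 0, which is [eser] without its first
    factor. *)
Lemma qsum_negq : (1 - q) * qsum (- q) 1 * vser F = eser F.
Proof.
have H : qlim (fun M => \prod_(i < M) (1 + - q * q ^+ i.+1)) (eser F / (1 - q)).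
  have u : 1 - q \is a GRing.unit by rewrite sunitE scoefB /= subr0 oner_eq0.
  have := qlimM (qlim_shift 1 (qlim_e F)) (qlim_cst (1 - q)^-1).
  apply: qlim_eq => M; rewrite addn1 /epart big_ord_recl mulrC expr1 mulrA mulVr // mul1r.
  by apply: eq_bigr => i _; rewrite mulNr -exprS.
have u : 1 - q \is a GRing.unit by rewrite sunitE scoefB /= subr0 oner_eq0.
by rewrite -mulrA (qsum_v H) mulrC divrK.
Qed.

Lemma poch0 k : poch (0 : S) k = 1.
Proof. by rewrite /poch big1 // => i _; rewrite mul0r subr0. Qed.

Lemma poch_negq k : poch (- q) k = vpart F k.
Proof. by apply: eq_bigr => i _; rewrite mulNr opprK -exprS. Qed.

End Euler.

(** * Partitions sorted by ones and by largest part *)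

Section Partitions.
Local Open Scope nat_scope.

Lemma geq_trans : transitive geq.
Proof. by move=> x y z /= xy zx; apply: leq_trans zx xy. Qed.

Definition ptns n : seq (seq nat) :=
  [seq parts t | t <- enum [set t : n.-bseq 'I_n.+1 | is_partition n (parts t)]].

Lemma ptns_uniq n : uniq (ptns n).
Proof. by rewrite map_inj_uniq ?enum_uniq //; apply: parts_inj. Qed.

Lemma mem_ptns n s : (s \in ptns n) = is_partition n s.
Proof.
apply/mapP/idP => [[t]|sn]; first by rewrite mem_enum inE => tn ->.
have [t tE] := partition_parts sn.
by exists t; rewrite ?mem_enum ?inE tE.
Qed.

Lemma num_partitions_count P n : num_partitions P n = count P (ptns n).
Proof.
rewrite /num_partitions /ptns count_map -sum1_count big_enum_cond /= sum1_card.
by apply: eq_card => t; rewrite !inE unfold_in inE.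
Qed.

Lemma sorted_ones s : sorted geq s -> 0 \notin s ->
  s = [seq x <- s | x != 1] ++ nseq (num_ones s) 1.
Proof.
rewrite /num_ones; elim: s => [|x s IH] //= xs; rewrite inE negb_or => /andP[x0 s0].
have ss : sorted geq s by apply: path_sorted xs.
case: eqP => [x1|_] /=; last by rewrite add0n -IH.
have sx : {in s, forall y, y <= 1}.
  by move=> y ys; have /allP /(_ _ ys) := order_path_min geq_trans xs; rewrite x1.
have f0 : [seq y <- s | y != 1] = [::].
  apply/eqP; rewrite -(negbK (_ == _)) -has_filter; apply/hasPn => y ys.
  have := sx _ ys; have : y != 0 by apply: contraNneq s0 => <-.
  by rewrite negbK; lia.
by rewrite f0 x1 /=; congr (_ :: _); rewrite {1}(IH ss s0) f0.
Qed.

Lemma is_partition_cat_ones j n s : (j <= n)%N -> 1 \notin s ->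
  is_partition n (s ++ nseq j 1) = is_partition (n - j) s.
Proof.
move=> jn s1; rewrite /is_partition sumn_cat sumn_nseq mul1n mem_cat mem_nseq andbF orbF.
rewrite !(sorted_pairwise geq_trans) pairwise_cat.
have -> : pairwise geq (nseq j 1).
  by rewrite -(sorted_pairwise geq_trans); case: j {jn} => //= j; elim: j => //= j ->.
have -> : (sumn s == n - j) = (sumn s + j == n) by rewrite -(eqn_add2r j) subnK.
rewrite andbT.
case: (boolP (0 \in s)) => s0; rewrite ?andbF //=; congr (_ && _).
case: allrelP => //=; case=> x y xs; rewrite mem_nseq => /andP[_ /eqP ->] /=.
by rewrite lt0n; apply: contraNneq s0 => <-.
Qed.

Lemma ptns_ones j n : (j <= n)%N ->
  perm_eq [seq s <- ptns n | num_ones s == j]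
          [seq s ++ nseq j 1 | s <- ptns (n - j) & 1 \notin s].
Proof.
move=> jn; apply: uniq_perm; first exact/filter_uniq/ptns_uniq.
  rewrite map_inj_in_uniq ?filter_uniq ?ptns_uniq // => s s' _ _.
  by move/(congr1 rev)/eqP; rewrite !rev_cat eqseq_cat // eqxx => /eqP /(can_inj revK).
move=> s; apply/idP/idP; rewrite mem_filter.
  case/andP=> /eqP sj; rewrite mem_ptns => sn.
  have [ss s0 _] := and3P sn; have E := sorted_ones ss s0; rewrite sj in E.
  apply/mapP; exists [seq x <- s | x != 1] => //.
  have n1 : 1 \notin [seq x <- s | x != 1] by rewrite mem_filter.
  by rewrite mem_filter n1 mem_ptns -is_partition_cat_ones // -E.
case/mapP=> s'; rewrite mem_filter mem_ptns => /andP[s1 sn] ->.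
rewrite mem_ptns is_partition_cat_ones // sn andbT /num_ones count_cat count_nseq /=.
by rewrite mul1n (count_memPn s1).
Qed.

(** If the part k + 1 occurs, it is the head of the sequence, and one copy is removed; the rest may
    contain it again. This recurrence produces the factors 1/(1 - q^(k+1)) and 1/(1 + q^(k+1)). *)
Lemma ptns_split (R : nmodType) (g : seq nat -> R) n k : (0 < k)%N ->
  (\sum_(s <- ptns n | all (fun x => 1 < x <= k.+1)%N s) g s =
   \sum_(s <- ptns n | all (fun x => 1 < x <= k)%N s) g s +
   (if (k < n)%N then \sum_(s <- ptns (n - k.+1) | all (fun x => 1 < x <= k.+1)%N s) g (k.+1 :: s)
    else 0))%R.
Proof.
move=> k0; rewrite (bigID (fun s => k.+1 \notin s)) /=; congr (_ + _)%R.
  apply: eq_bigl => s; apply/andP/idP => [[/allP sk ks]|/allP sk].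
    apply/allP => x xs; have := sk _ xs; have : x != k.+1 by apply: contraNneq ks => <-.
    lia.
  split; first by apply/allP => x /sk; lia.
  by apply/negP => /sk; lia.
case: ltnP => kn; last first.
  rewrite big_seq_cond big1 // => s /andP[sn /andP[_ ks]].
  exfalso; move: sn ks; rewrite mem_ptns => /and3P[_ _ /eqP sn]; rewrite negbK => ks.
  have : (k.+1 <= sumn s)%N.
    elim: s ks {sn} => //= x s IH; rewrite inE => /orP[/eqP ->|/IH]; lia.
  by rewrite sn; lia.
rewrite -big_filter -[RHS]big_filter.
have -> : (\sum_(s <- [seq s <- ptns (n - k.+1) | all (fun x => 1 < x <= k.+1)%N s]) g (k.+1 :: s) =
  \sum_(s <- [seq k.+1 :: s | s <- ptns (n - k.+1) & all (fun x => 1 < x <= k.+1)%N s]) g s)%R.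
  by rewrite big_map.
apply: perm_big; apply: uniq_perm; first exact/filter_uniq/ptns_uniq.
  by rewrite map_inj_uniq ?filter_uniq ?ptns_uniq // => s s' [].
have consP s : all (fun x => 1 < x <= k.+1)%N s ->
    is_partition n (k.+1 :: s) = is_partition (n - k.+1) s.
  move=> /allP sk; rewrite /is_partition /= inE negb_or /=.
  rewrite (path_sortedE geq_trans) (_ : all (geq k.+1) s) /=; last first.
    by apply/allP => x /sk /=; lia.
  by have -> : (sumn s == n - k.+1) = (k.+1 + sumn s == n) by rewrite -(eqn_add2l k.+1) subnKC.
move=> s; rewrite mem_filter mem_ptns negbK; apply/idP/mapP.
  case/andP=> /andP[/allP sk ks] sn; case: s sk ks sn => // x s sk ks sn.
  have xk : x = k.+1.
    have [xs _ _] := and3P sn.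
    have := sk x (mem_head _ _); move: ks; rewrite inE => /orP[/eqP -> //|ks].
    by have /allP /(_ _ ks) /= := order_path_min geq_trans xs; lia.
  have sk' : all (fun x => 1 < x <= k.+1)%N s.
    by apply/allP => y ys; apply: sk; rewrite inE ys orbT.
  by exists s; rewrite ?xk // mem_filter sk' mem_ptns -consP // -xk.
case=> s'; rewrite mem_filter mem_ptns => /andP[sk sn] ->.
by rewrite /= sk mem_head consP // sn ltnS k0 leqnn.
Qed.

Lemma even_crank_ones j s : (0 < j)%N -> 1 \notin s ->
  even_crank (s ++ nseq j 1) = (odd (count (fun x => j < x)%N s) == odd j).
Proof.
move=> j0 s1; have nj : num_ones (s ++ nseq j 1) = j.
  by rewrite /num_ones count_cat count_nseq /= mul1n (count_memPn s1).
rewrite /even_crank /crank nj gtn_eqF // /num_above nj count_cat count_nseq.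
by rewrite ltnNge j0 mul0n addn0 -eqz_mod_dvd !modz_nat eqz_nat !modn2; do 2!case: odd.
Qed.

Lemma even_crank_no_ones s : 1 \notin s -> even_crank s = ~~ odd (largest_part s).
Proof.
move=> s1; rewrite /even_crank /crank /num_ones (count_memPn s1) /=.
by rewrite dvdzE /= dvdn2.
Qed.

End Partitions.

(** * From the crank to the infinite product *)

Section CrankSeries.
Variable F : fieldType.
Local Notation S := (series F).
Local Notation q := (@qvar F).

Definition csign s : F := if even_crank s then 1 else -1.

Lemma MeMo_csign n : n != 1%N -> (MeMo n)%:~R = \sum_(s <- ptns n) csign s.
Proof.
move=> n1; rewrite /MeMo /Me /Mo (negPf n1) !num_partitions_count.
rewrite rmorphB /= -!pmulrn -!sum1_count !natr_sum.
rewrite [RHS](bigID even_crank) /=; congr (_ + _).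
  by apply: eq_bigr => s; rewrite /csign => ->.
by rewrite -sumrN; apply: eq_bigr => s; rewrite /csign => /negPf ->.
Qed.

(** For j, k >= 1 this is the product of 1/(1 - q^i) over those 2 <= i <= k with i <= j and 1/(1 +
    q^i) over the others. Here j stands for the number of ones, and the parts above j are those that
    the crank counts. *)
Definition wser j k : S := Series (fun n =>
  \sum_(s <- ptns n | all (fun x => 1 < x <= k)%N s) (-1) ^+ count (fun x => j < x)%N s).
Definition wlim j : S := Series (fun n =>
  \sum_(s <- ptns n | 1%N \notin s) (-1) ^+ count (fun x => j < x)%N s).
Definition lser k : S := Series (fun n =>
  \sum_(s <- ptns n | all (fun x => 1 < x <= k)%N s) (-1) ^+ largest_part s).
Definition llim : S := Series (fun n =>
  \sum_(s <- ptns n | 1%N \notin s) (-1) ^+ largest_part s).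

Lemma big_ptns_nil (g : seq nat -> F) n :
  \sum_(s <- ptns n | all (fun x => 1 < x <= 1)%N s) g s = if n == 0%N then g [::] else 0.
Proof.
rewrite -big_filter.
have nilP s : all (fun x => 1 < x <= 1)%N s -> s = [::].
  by case: s => //= x s /andP[]; lia.
case: eqP => [->|n0]; last first.
  rewrite big_seq big1 // => s; rewrite mem_filter => /andP[/nilP ->].
  by rewrite mem_ptns /is_partition /= => /eqP; lia.
rewrite (perm_big [:: [::]]) /=; first by rewrite big_seq1.
apply: uniq_perm => //; first exact/filter_uniq/ptns_uniq.
move=> s; rewrite mem_filter inE; apply/andP/eqP => [[/nilP]//|->].
by rewrite mem_ptns.
Qed.

Lemma wser1 j : wser j 1 = 1.
Proof. by apply: seriesP => n; rewrite /= big_ptns_nil; case: eqP. Qed.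

Lemma lser1 : lser 1 = 1.
Proof.
apply: seriesP => n; rewrite /= big_ptns_nil; case: eqP => // _.
by rewrite /largest_part big_nil.
Qed.

Lemma wserS j k : (0 < k)%N ->
  wser j k.+1 = wser j k + (-1) ^+ (j < k.+1)%N * q ^+ k.+1 * wser j k.+1.
Proof.
move=> k0; apply: seriesP => n; rewrite scoefD -mulrA.
have -> (u : S) : ((-1) ^+ (j < k.+1)%N * u) n = (-1) ^+ (j < k.+1)%N * u n.
  by rewrite sign_coef.
rewrite scoef_qXM {1}/wser [scoef (Series _) n]/= ptns_split //; congr (_ + _).
case: ifP => _; last by rewrite mulr0.
by rewrite mulr_sumr; apply: eq_bigr => s _ /=; rewrite exprD.
Qed.

Lemma lserS k : (0 < k)%N ->
  lser k.+1 = lser k + (-1) ^+ k.+1 * q ^+ k.+1 * wser k.+1 k.+1.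
Proof.
move=> k0; apply: seriesP => n; rewrite scoefD -mulrA sign_coef scoef_qXM.
rewrite {1}/lser [scoef (Series _) n]/= ptns_split //; congr (_ + _).
case: ifP => _; last by rewrite mulr0.
rewrite mulr_sumr; apply: eq_bigr => s sk.
have -> : largest_part (k.+1 :: s) = k.+1.
  rewrite /largest_part big_cons; apply/maxn_idPl/bigmax_leqP_seq => x xs _.
  by have /allP /(_ _ xs) /andP[] := sk.
have /eqP -> : count (fun x => k.+1 < x)%N s == 0%N; last by rewrite mulr1.
rewrite -leqn0 leqNgt -has_count; apply/hasPn => x xs.
by have /allP /(_ _ xs) := sk; lia.
Qed.

Lemma wser_epart j k : (0 < k <= j)%N -> wser j k * epart F k = 1 - q.
Proof.
elim: k => // -[|k] IH kj.
  by rewrite wser1 mul1r /epart big_ord1 expr1.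
have := wserS j (ltn0Sn k); rewrite ltnNge (_ : (k.+2 <= j)%N) //= expr0 mul1r => H.
rewrite -IH; last by lia.
rewrite epartS; transitivity ((wser j k.+2 * (1 - q ^+ k.+2)) * epart F k.+1); first by ring.
by congr (_ * _); rewrite mulrBr mulr1 {1}H; ring.
Qed.

Lemma wser_vpart j k : (0 < j <= k)%N -> wser j k * (epart F j * vpart F k) = (1 - q) * vpart F j.
Proof.
case/andP=> j0 jk; rewrite -(subnKC jk); elim: (k - j)%N => [|i IH].
  by rewrite addn0 mulrA wser_epart // j0 leqnn.
rewrite -IH addnS vpartS; have := wserS j (leq_trans j0 (leq_addr i j)).
rewrite ltnS leq_addr expr1 => H.
transitivity ((wser j (j + i).+1 * (1 + q ^+ (j + i).+1)) * (epart F j * vpart F (j + i))).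
  by ring.
by congr (_ * _); rewrite mulrDr mulr1 {1}H; ring.
Qed.

Lemma ptns_stable n k s : (n <= k)%N -> s \in ptns n ->
  all (fun x => 1 < x <= k)%N s = (1%N \notin s).
Proof.
move=> nk; rewrite mem_ptns => /and3P[_ s0 /eqP sn]; apply/allP/idP => [H|s1 x xs].
  by apply/negP => /H.
have : (x <= sumn s)%N.
  elim: s xs {s0 s1 sn} => //= y s IH; rewrite inE => /orP[/eqP ->|/IH]; lia.
have : x != 0%N by apply: contraNneq s0 => <-.
have : x != 1%N by apply: contraNneq s1 => <-.
lia.
Qed.

Lemma qlim_ptns (g : seq nat -> F) :
  qlim (fun k => Series (fun n => \sum_(s <- ptns n | all (fun x => 1 < x <= k)%N s) g s))
       (Series (fun n => \sum_(s <- ptns n | 1%N \notin s) g s)).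
Proof.
move=> n; exists n => k nk i i_n /=; rewrite big_seq_cond [RHS]big_seq_cond.
by apply: eq_bigl => s; case: (boolP (s \in _)) => //= si; rewrite (ptns_stable (leq_trans i_n nk)).
Qed.

Lemma wlimE j : (0 < j)%N -> wlim j * (epart F j * vser F) = (1 - q) * vpart F j.
Proof.
move=> j0.
have H := qlim_shift j (qlimM (qlim_ptns _) (qlimM (qlim_cst (epart F j)) (qlim_v F))).
apply: (qlim_unique (H _)); apply: qlim_eq (qlim_cst _) => k.
by rewrite -(@wser_vpart j (k + j)) ?j0 ?leq_addl.
Qed.

(** Partitions with largest part i >= 2 contribute (-1)^i q^i (1 - q) / e_i, the i-th term on the
    right. The terms i = 0, 1 give 1 - 2q there, while the empty partition contributes 1; hence the
    correction 2q. *)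
Lemma lserE k : (0 < k)%N ->
  lser k = (1 - q) * \sum_(i < k.+1) qterm 0 1 i + q *+ 2.
Proof.
have qt i : qterm (0 : S) 1 i = (-1) ^+ i * q ^+ i * (epart F i)^-1.
  by rewrite /qterm poch0 mul1r mul1n.
elim: k => // -[|k] IH _.
  have u : 1 - q \is a GRing.unit by rewrite sunitE scoefB /= subr0 oner_eq0.
  have e0 : epart F 0 = 1 by rewrite /epart big_ord0.
  have e1 : epart F 1 = 1 - q by rewrite /epart big_ord1 expr1.
  rewrite lser1 !big_ord_recl big_ord0 addr0 !qt lift0 e0 e1 invr1.
  transitivity (1 - q - q * ((1 - q) * (1 - q)^-1) + q *+ 2); last by ring.
  by rewrite mulrV //; ring.
rewrite lserS // IH // [in RHS]big_ord_recr /= qt mulrDr.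
have W : wser k.+2 k.+2 = (1 - q) * (epart F k.+2)^-1.
  by rewrite -(@wser_epart k.+2 k.+2) ?leqnn // mulrK // epart_unit.
by rewrite W; ring.
Qed.

Lemma llimE : llim * vser F = (1 - q) + q * vser F *+ 2.
Proof.
have H : llim = (1 - q) * qsum 0 1 + q *+ 2.
  apply: (qlim_unique (qlim_shift 1 (qlim_ptns _))).
  have := qlimD (qlimM (qlim_cst (1 - q)) (qlim_shift 2 (qlim_qsum (0 : S) (ltn0Sn 0)))) (qlim_cst (q *+ 2)).
  apply: qlim_eq => k; rewrite (_ : k + 2 = (k + 1).+1)%N; last by lia.
  by apply/esym/lserE; lia.
by rewrite H mulrDl -mulrA euler_v mulr1 mulrnAl.
Qed.

Lemma csign_sum n : \sum_(s <- ptns n) csign s =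
  llim n + \sum_(j < n) (-1) ^+ j.+1 * wlim j.+1 (n - j.+1)%N.
Proof.
have inN s : s \in ptns n -> (num_ones s < n.+1)%N.
  rewrite mem_ptns ltnS => /and3P[_ _ /eqP <-]; rewrite /num_ones.
  by elim: s => //= x s IH; case: eqP => [->|]; lia.
rewrite big_seq_cond (partition_big (fun s => inord (num_ones s) : 'I_n.+1) predT) //=.
have E (j : 'I_n.+1) : \sum_(s <- ptns n | (s \in ptns n) && true && (inord (num_ones s) == j)) csign s =
   \sum_(s <- ptns (n - j) | 1%N \notin s) csign (s ++ nseq j 1%N).
  transitivity (\sum_(s <- [seq s <- ptns n | num_ones s == j]) csign s).
    rewrite big_filter [RHS]big_seq_cond; apply: eq_bigl => s.
    by case: (boolP (s \in _)) => //= /inN sn; rewrite -val_eqE /= inordK.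
  have jn : (j <= n)%N by rewrite -ltnS.
  by rewrite (perm_big _ (ptns_ones jn)) big_map big_filter.
rewrite (eq_bigr _ (fun j _ => E j)) big_ord_recl subn0; congr (_ + _).
  by apply: eq_bigr => s s1; rewrite cats0 /csign even_crank_no_ones // -signr_odd; case: odd.
apply: eq_bigr => j _; rewrite lift0 mulr_sumr; apply: eq_bigr => s s1.
rewrite /csign even_crank_ones // -[(-1) ^+ j.+1]signr_odd -[(-1) ^+ count _ _]signr_odd.
by do 2!case: odd; rewrite ?expr0 ?expr1 ?mulrNN ?mulr1 ?mul1r.
Qed.

Definition cser : S := Series (fun n => (MeMo n)%:~R).

(** At n = 1 the convention gives -3, whereas the partition 1 has crank -1 and sign -1. *)
Lemma cser_naive : cser + q *+ 2 = Series (fun n => \sum_(s <- ptns n) csign s).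
Proof.
apply: seriesP => n; rewrite scoefD scoefMn.
have [->|n1] := eqVneq n 1%N; last first.
  by rewrite -[RHS]/(\sum_(s <- ptns n) csign s) -MeMo_csign //= (negPf n1) mul0rn addr0.
rewrite -[RHS]/(\sum_(s <- ptns 1) csign s).
rewrite (perm_big [:: [:: 1%N]]); last first.
  apply: uniq_perm; rewrite ?ptns_uniq // => s; rewrite mem_ptns inE.
  apply/idP/eqP => [|->] //; case: s => [|[|[|x]] [|[|y] s]] //=; rewrite /is_partition /= ?andbF //; lia.
have e1 : cser 1%N = - 3%:R by [].
have e2 : q 1%N = 1 by [].
have e3 : csign [:: 1%N] = - 1 by [].
by rewrite big_seq1 e1 e2 e3; ring.
Qed.

(** Multiplied by [vser], the partitions with j >= 1 ones contribute 1 - q times the j-th term of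
    the q-binomial series with a = -q, and those without ones supply its term j = 0. The 2q of
    [llimE] cancels the 2q of the crank convention. *)
Theorem crank_parity_product : cser * vser F ^+ 2 = eser F.
Proof.
have v0 := vser_neq0 F.
have L : qlim (fun K => llim + \sum_(j < K) (-1) ^+ j.+1 * (q ^+ j.+1 * wlim j.+1)) (cser + q *+ 2).
  move=> n; exists n => K nK i i_n; rewrite cser_naive scoefD -[RHS]/(\sum_(s <- ptns i) csign s) csign_sum; congr (_ + _).
  rewrite scoef_sum (big_ord_widen K (fun j => (-1) ^+ j.+1 * wlim j.+1 (i - j.+1)%N)); last exact: leq_trans nK.
  rewrite [RHS]big_mkcond; apply: eq_bigr => j _; rewrite sign_coef scoef_qXM.
  by case: ifP => _; rewrite ?mulr0.
have L2 := qlimM L (qlim_cst (vser F)).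
have L3 : qlim (fun K => llim * vser F + (1 - q) * (\sum_(k < K + 1) qterm (- q) 1 k - 1)) ((cser + q *+ 2) * vser F).
  apply: qlim_eq L2 => K; rewrite mulrDl; congr (_ + _); rewrite addn1 big_ord_recl qterm0 addrAC subrr add0r.
  rewrite mulr_suml mulr_sumr; apply: eq_bigr => j _.
  rewrite /qterm poch_negq mul1n lift0; have := @wlimE j.+1 isT.
  have eu := epart_unit F j.+1 => H.
  transitivity ((-1) ^+ j.+1 * q ^+ j.+1 * ((wlim j.+1 * (epart F j.+1 * vser F)) * (epart F j.+1)^-1)).
    transitivity ((-1) ^+ j.+1 * q ^+ j.+1 * wlim j.+1 * vser F * (epart F j.+1 * (epart F j.+1)^-1)).
      by rewrite mulrV //; ring.
    by ring.
  by rewrite H; ring.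
have L4 := qlimD (qlim_cst (llim * vser F)) (qlimM (qlim_cst (1 - q))
   (qlimD (qlim_shift 1 (qlim_qsum (- q) (ltn0Sn 0))) (qlim_cst (-1)))).
have E := qlim_unique L3 L4; rewrite llimE in E.
have E2 : cser * vser F = (1 - q) * qsum (- q) 1.
  apply: (addIr (q * vser F *+ 2)); transitivity ((cser + q *+ 2) * vser F); first by ring.
  by rewrite E; ring.
by rewrite expr2 mulrA E2 qsum_negq.
Qed.

End CrankSeries.

Lemma delta_spec l : prime l -> (5 <= l)%N -> (24 * delta l + 1 = l ^ 2)%N.
Proof.
move=> pl l5.
have l2 : ~~ (2 %| l)%N by rewrite dvdn_prime2 //; lia.
have l3 : ~~ (3 %| l)%N by rewrite dvdn_prime2 //; lia.
have E : (l ^ 2 %% 24 = 1)%N.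
  rewrite -modnXm; have := ltn_pmod l (ltn0Sn 23).
  have r2 : ~~ (2 %| l %% 24)%N by rewrite /dvdn modn_dvdm.
  have r3 : ~~ (3 %| l %% 24)%N by rewrite /dvdn modn_dvdm.
  by move: (l %% 24)%N r2 r3; do 24 ?[case; first by []].
rewrite /delta; move: E; rewrite (divn_eq (l ^ 2) 24); lia.
Qed.

(** * The congruences *)

Section PrimeField.
Variable l : nat.
Hypothesis l_prime : prime l.
Local Notation F := 'F_l.

Lemma Fp_frob (x : F) : x ^+ l = x.
Proof.
have := pFrobenius_autE (pchar_Fp l_prime) x => <-.
by rewrite -[x]natr_Zp pFrobenius_aut_nat.
Qed.

Lemma Fp_int_eq0 (z : int) : (z%:~R == 0 :> F) = (l %| z)%Z.
Proof. by rewrite (intF_eq0 (pchar_Fp l_prime)) dvdzE. Qed.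

Lemma Fp_int_eq (y z : int) : (y%:~R == z%:~R :> F) = (y == z %[mod l])%Z.
Proof. by rewrite -subr_eq0 -rmorphB Fp_int_eq0 eqz_mod_dvd. Qed.

Lemma square_mod z :
  [exists x : 'I_l, (Posz x ^+ 2 == z %[mod l])%Z] = [exists x : F, x ^+ 2 == z%:~R].
Proof.
apply/existsP/existsP => [[x]|[x]].
  by rewrite -Fp_int_eq rmorphXn /= => xz; exists (x%:R).
move=> /eqP xz; have xl : (x < l)%N.
  by have := ltn_ord x; rewrite [X in (_ < X)%N -> _](Fp_cast l_prime).
by exists (Ordinal xl); rewrite -Fp_int_eq rmorphXn /= -xz -[X in _ == X ^+ 2]natr_Zp.
Qed.

Variable m : nat.
Hypothesis lE : l = m.*2.+1.

(** Nonsquares are odd powers of a generator g, and g^(2m) = 1, so that c = g^m works for all of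
    them. *)
Lemma euler_nonsquare : exists c : F, forall u : F, u != 0 ->
  ~~ [exists x : F, x ^+ 2 == u] -> u ^+ m = c.
Proof.
have /cyclicP[g gG] := field_unit_group_cyclic [set: {unit F}]%G.
exists (val g ^+ m) => u u0 nsq.
have uU : u \is a GRing.unit by rewrite unitfE.
have : FinRing.unit F uU \in <[g]>%g by rewrite -gG inE.
case/cycleP=> k /(congr1 val) /=; rewrite FinRing.val_unitX => uE.
have ok : odd k.
  apply: contraNT nsq => ek; apply/existsP; exists (val g ^+ k./2).
  by rewrite -exprM muln2 even_halfK // uE.
have g0 : val g != 0 by rewrite -unitfE; case: (g).
have g2 : (val g ^+ m) ^+ 2 = 1.
  by rewrite -exprM muln2; apply: (mulfI g0); rewrite mulr1 -exprS -lE Fp_frob.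
rewrite uE -exprM mulnC exprM -(odd_double_half k) ok exprD expr1 -mul2n exprM g2.
by rewrite expr1n mulr1.
Qed.

Lemma square_power (u : F) : u != 0 -> [exists x : F, x ^+ 2 == u] -> u ^+ m = 1.
Proof.
move=> u0 /existsP[x /eqP xu]; have x0 : x != 0.
  by apply: contraNneq u0 => x0; rewrite -xu x0 expr0n.
rewrite -xu -exprM mul2n; apply: (mulfI x0).
by rewrite mulr1 -exprS -lE Fp_frob.
Qed.

Lemma legendre_power y z : ~~ (l %| y)%Z -> legendre l y = legendre l z ->
  y%:~R ^+ m = z%:~R ^+ m :> F.
Proof.
have n1 : (1 == 0 :> int) = false by [].
have n2 : (-1 == 0 :> int) = false by [].
have n3 : (1 == -1 :> int) = false by [].
move=> ly; rewrite /legendre (negPf ly).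
case: (boolP (l %| z)%Z) => lz.
  by case: ifP => _ /eqP; rewrite ?n1 ?n2.
have y0 : y%:~R != 0 :> F by rewrite Fp_int_eq0.
have z0 : z%:~R != 0 :> F by rewrite Fp_int_eq0.
rewrite !square_mod; case: ifP => ysq; case: ifP => zsq.
- by rewrite !square_power.
- by move/eqP; rewrite n3.
- by move/eqP; rewrite eq_sym n3.
by have [c H] := euler_nonsquare; rewrite !H ?ysq ?zsq.
Qed.

End PrimeField.

Theorem theorem1p3 (l : nat) (l_prime : prime l) (l_ge5 : (5 <= l)%N) :
  ((forall n : int, (MeMo (l%:Z * n - (delta l)%:Z)%R = 0 %[mod l])%Z)
     <-> l = 5%N)
  /\
  (forall a : int,
     ~ (a = (- (delta l)%:Z)%R %[mod l])%Z ->
     (forall n : int, (MeMo (l%:Z * n + a)%R = 0 %[mod l])%Z) ->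
     forall b : int,
       legendre l (a + (delta l)%:Z)%R = legendre l (b + (delta l)%:Z)%R ->
       forall n : int, (MeMo (l%:Z * n + b)%R = 0 %[mod l])%Z).
Proof.
have charF := pchar_Fp l_prime.
have [K [iota _]] := countable_algebraic_closure 'F_l.
pose m := l./2; have lE : l = m.*2.+1.
  have : odd l by case/even_prime: (l_prime) => // l2; move: l_ge5; rewrite l2.
  by move=> lo; rewrite -[LHS]odd_double_half lo.
have fv : cser 'F_l * vser 'F_l = tser 'F_l.
  apply: (mulIf (vser_neq0 'F_l)); rewrite gauss ?(pchar_neq2 charF lE l_ge5) //.
  by rewrite -crank_parity_product expr2 mulrA.
have dE : 24%:R * (delta l)%:R = -1 :> 'F_l.
  apply/eqP; rewrite -addr_eq0 -natrM -(natrD _ _ 1) delta_spec // natrX.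
  by rewrite (pcharf0 charF) expr0n.
have l0 : l%:Z%:~R = 0 :> 'F_l by exact: pcharf0 charF.
have modP (z : int) : (z = 0 %[mod l])%Z <-> z%:~R = 0 :> 'F_l.
  split=> [/eqP|/eqP]; last by rewrite -(rmorph0 (intmul 1)) Fp_int_eq // => /eqP.
  by rewrite -Fp_int_eq // rmorph0 => /eqP.
have MeMoP (c : int) : (forall n : int, (MeMo (l%:Z * n + c)%R = 0 %[mod l])%Z) <->
    (forall k : nat, (k + delta l)%:R = (c + (delta l)%:Z)%:~R :> 'F_l -> cser 'F_l k = 0).
  split=> H.
    move=> k kc; apply/modP.
    have : (l %| k%:Z - c)%Z.
      rewrite -Fp_int_eq0 // rmorphB /= subr_eq0; apply/eqP.
      by apply: (addIr (delta l)%:R); rewrite -natrD kc rmorphD.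
    case/dvdzP => n kE; have := H n; suff -> : l%:Z * n + c = k%:Z by [].
    by rewrite mulrC -kE subrK.
  (* At negative arguments [MeMo] is 0 by definition, so only natural exponents k remain. *)
  move=> n; apply/modP; case E : (l%:Z * n + c) => [k|k]; last by [].
  apply: (H k); rewrite -[LHS]/((k + delta l)%N%:Z%:~R) PoszD -E !rmorphD rmorphM /=.
  by rewrite l0 mul0r add0r.
split.
  split.
    move=> H; apply/eqP; apply: contrapT => /negP l5.
    have l7 : (7 <= l)%N.
      have l6 : l != 6%N by apply: contraTneq l_prime => ->.
      lia.
    have {}H := (MeMoP _).1 (fun n => H n).
    apply: (no_congruence charF lE l_ge5 iota fv dE l7) => n nd.
    by apply: H; rewrite nd addNr rmorph0.
  move=> l5 n; move: n; apply/MeMoP => k kd.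
  have char5 : 5%N \in [pchar 'F_l] by rewrite -{1}l5.
  apply: (congruence5 char5 fv dE).
  by rewrite kd addNr rmorph0.
move=> a an Ha b ab; have {Ha}Ha := (MeMoP a).1 Ha.
have la : ~~ (l %| a + (delta l)%:Z)%Z.
  apply/negP => la; apply: an; apply/eqP; rewrite eqz_mod_dvd opprK //.
pose r := `|((a + (delta l)%:Z) %% l)%Z|%N.
have rE : r%:R = (a + (delta l)%:Z)%:~R :> 'F_l.
  apply/eqP; rewrite -[X in X == _]/(r%:Z%:~R) Fp_int_eq //.
  by rewrite /r gez0_abs ?modz_ge0 ?modz_mod //; lia.
apply/MeMoP => k kb; apply: (class_transfer charF lE l_ge5 iota fv dE (r := r)).
- by rewrite rE Fp_int_eq0.
- by move=> i; rewrite rE; apply: Ha.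
by rewrite kb rE; apply/esym/legendre_power.
Qed.
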